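(* For every complex number $z$ and for every real number $Q\geq 1$, there exist Gaussian integers $p$ and $q$ (i.e. $p,q\in\mathbb Z[i]=\mathbb Z+i\mathbb Z$) such that \[ 0<|q|< Q \quad\text{and}\quad |qz-p|\leq \frac{\sqrt 2}{3-\sqrt 3}\cdot\frac{1}{Q}, \] where $\frac{\sqrt 2}{3-\sqrt 3}=\frac{1}{\sqrt{6-3\sqrt 3}}=1.115355\dots$. Furthermore, the set of complex numbers $z$ for which the constant $\frac{\sqrt 2}{3-\sqrt 3}$ in this statement can be improved (i.e. replaced by a smaller constant $C$ such that for every $Q\geq 1$ there exist Gaussian integers $p,q$ with $0<|q|<Q$ and $|qz-p|\leq C/Q$) has zero Lebesgue measure.
   Context: Complex analogue of Dirichlet's approximation theorem, approximating complex numbers by quotients of Gaussian integers; $|\cdot|$ denotes the complex modulus.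
   Formalization: The range ''Q ≥ 1'' is replaced by Q > 1 in both parts, since at Q = 1 no Gaussian integer q satisfies 0 < |q| < 1, so the claim fails there for every z. *)

(* Defs.v *)
From HB Require Import structures.
From mathcomp Require Import all_boot all_order all_algebra.
From mathcomp Require Import all_classical all_reals all_analysis.
From mathcomp Require Import complex.

Set Implicit Arguments.
Unset Strict Implicit.
Unset Printing Implicit Defensive.

Import Order.TTheory GRing.Theory Num.Theory.

Local Open Scope classical_set_scope.
Local Open Scope ring_scope.
Local Open Scope complex_scope.

Definition gaussian_integers (R : realType) : set R[i] :=
  [set w | exists a b : int, w = a%:~R +i* b%:~R].

(* The order and the norm of R[i] take values in R[i]: on real parameters they
   are compared through the embedding _%:C.  The range is Q > 1: a nonzero
   Gaussian integer has modulus at least 1, so no q satisfies 0 < |q| < 1. *)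
Definition dirichlet_constant (R : realType) (z : R[i]) (C : R) : Prop :=
  forall Q : R, 1 < Q ->
  exists p q : R[i],
    [/\ gaussian_integers p, gaussian_integers q,
        0 < `|q| < Q%:C & `|q * z - p| <= (C / Q)%:C].

(* Lebesgue measure of the plane, with R[i] identified with R * R;
   [negligible] asks for inclusion in a Borel set of measure zero, so it
   applies to sets not known to be measurable. *)
Definition lebesgue_nullC (R : realType) (A : set R[i]) : Prop :=
  ((@lebesgue_measure R) \x (@lebesgue_measure R))%E.-negligible
    [set xy | A (xy.1 +i* xy.2)].

(* Main.v *)
Require Import Defs.
From HB Require Import structures.
From mathcomp Require Import all_boot all_order all_algebra.
From mathcomp Require Import all_classical all_reals all_analysis.
From mathcomp Require Import complex.
From mathcomp Require Import ring lra zify.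

(** For a pair (q, p) of Gaussian integers consider the vector (q, q z - p) of the
    Gaussian lattice attached to z.

    Existence.  Let v be the vector with smallest |q| among those with |q z - p| <= c/Q.
    If |q_v| >= Q, let u be the vector with smallest second coordinate among those with
    |q| < |q_v|.  Then the open polydisc of radii |q_v|, |y_u| contains no lattice point,
    and one has to show |q_v y_u| <= c.  After rescaling, u = (a, 1) and v = (1, b) with
    |a|, |b| < 1, and D = det (u, v) satisfies |D| = |q_v y_u| |1 - a b|.  Completing u to a
    basis and reducing v modulo u, emptiness of the polydisc forces |D|^2 <= 2.
    If |D|^2 = 2, the four vectors (u + e v)/(1 + i), e a unit, avoid the polydisc; if
    |D| = 1, the vectors s u + t v with |s|^2, |t|^2 <= 2 do.  In both cases a planar
    optimization gives |1 - a b|^2 >= |D|^2 (6 - 3 sqrt 3), which is |D|^2 / c^2.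

    Optimality.  Equality holds for a = t (1 + i), b = - t (1 - i), t = (sqrt 3 - 1)/2, |D|^2 = 2.
    Let C < c.  If a basis of the lattice of z is, up to diagonal scaling, close to
    a basis of this critical lattice, then C fails for z.  Near every irreducible fraction
    p/q there is a disc of such z, of radius and distance to p/q comparable with 1/|q|^2:
    one fixed unimodular change of basis brings the ratio of the first coordinates near
    the critical value, and the ratio of the second ones is a Moebius function of z.
    Since every irrational z is approximated by infinitely many p/q up to c/|q|^2, the
    set where C holds is porous outside a countable set, hence negligible by a Vitali
    covering argument. *)

Set Implicit Arguments.
Unset Strict Implicit.
Unset Printing Implicit Defensive.

Import Order.TTheory GRing.Theory Num.Theory.
Import numFieldNormedType.Exports.
Import ComplexField.Normc.

Local Open Scope classical_set_scope.
Local Open Scope ring_scope.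
Local Open Scope complex_scope.

Local Notation Re := complex.Re.
Local Notation Im := complex.Im.

(** * Planar inequalities *)

(** The last hypothesis puts (x, y) outside the open unit disc centred at (0, 1). As y <= 1, the
    point lies below the lower arc, and that arc lies below its chord from the origin to (1/2, 1 -
    k/2), of slope 2 - k. *)
Lemma chord_bound (R : realFieldType) (k x y : R) :
  0 < k -> k ^+ 2 = 3 -> 0 <= x -> x <= 1/2 -> y <= 1 ->
  2 * y <= x ^+ 2 + y ^+ 2 -> y <= (2 - k) * x.
Proof.
move=> k0 k3 x0 x1 y1 h.
have k2 : k < 2 by rewrite ltNge; apply/negP => ?; nra.
have lx : (2 - k) * x <= 1/2 by nra.
rewrite leNgt; apply/negP => hy.
have lE : (2 - k) ^+ 2 = 4 * (2 - k) - 1 by lra.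
have h1 : 2 * ((2 - k) * x) - ((2 - k) * x) ^+ 2 < 2 * y - y ^+ 2.
  rewrite -subr_gt0 (_ : _ - _ = (y - (2 - k) * x) * (2 - y - (2 - k) * x)); last by ring.
  by apply: mulr_gt0; lra.
have h2 : 0 < x ^+ 2 - (2 * ((2 - k) * x) - ((2 - k) * x) ^+ 2) by lra.
move: h2; rewrite exprMn lE (_ : _ - _ = (2 - k) * (2 * x) * (2 * x - 1)); last by ring.
rewrite ltNge => /negP; apply; apply: mulr_ge0_le0; [apply: mulr_ge0; lra|lra].
Qed.

(** The last two hypotheses exclude the open unit discs centred at (0, 1) and (1, 1). The symmetry x
    -> 1 - x exchanges them, so [chord_bound] applies to x or to 1 - x, whichever is at most 1/2. *)
Lemma height_bounds (R : realFieldType) (k x y : R) :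
  0 < k -> k ^+ 2 = 3 -> y <= x -> - x <= y -> x ^+ 2 + y ^+ 2 <= 1 ->
  2 * y <= x ^+ 2 + y ^+ 2 -> 2 * (x + y) <= 1 + (x ^+ 2 + y ^+ 2) ->
  y <= (2 - k) * x /\ y <= (2 - k) * (1 - x).
Proof.
move=> k0 k3 yx xy s1 h1 h2.
have k2 : k < 2 by rewrite ltNge; apply/negP => ?; nra.
have x1 : x <= 1 by rewrite leNgt; apply/negP => ?; nra.
have y1 : y <= 1 by lra.
have [x2|x2] := leP x (1/2).
  have h := chord_bound k0 k3 (_ : 0 <= x) x2 y1 h1; split; first by apply: h; lra.
  apply: le_trans (h _) _; [lra|rewrite ler_wpM2l//; lra].
have h := @chord_bound _ k (1-x) y k0 k3 _ _ y1 _.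
have {}h : y <= (2 - k) * (1 - x) by apply: h; nra.
by split => //; apply: le_trans h _; rewrite ler_wpM2l//; lra.
Qed.

(** The difference is (y0 - y) (2 X - (y0 + y) S) with S = X^2 + Y^2, where y0 + y <= 1 and S <= 2
    X^2 <= 2 X. *)
Lemma skew_form_mono (R : realFieldType) (x y y0 X Y : R) :
  0 <= x -> x <= 1 -> 0 <= X -> - X <= Y -> Y <= X -> X ^+ 2 + Y ^+ 2 <= 1 -> y <= y0 ->
    y0 <= 1/2 ->
  2 * (x * Y + X * y) - (x ^+ 2 + y ^+ 2) * (X ^+ 2 + Y ^+ 2) <=
  2 * (x * Y + X * y0) - (x ^+ 2 + y0 ^+ 2) * (X ^+ 2 + Y ^+ 2).
Proof.
move=> x0 x1 X0 XY YX S1 yy0 y02.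
set S := X ^+ 2 + Y ^+ 2 in S1 *.
rewrite -subr_ge0 (_ : _ - _ = (y0 - y) * (2 * X - (y0 + y) * S)); last by ring.
apply: mulr_ge0; first lra.
have S0 : 0 <= S by rewrite addr_ge0 ?sqr_ge0.
have X1 : X <= 1 by rewrite leNgt; apply/negP => ?; rewrite /S in S1; nra.
have : 0 <= (X - Y) * (X + Y) by apply: mulr_ge0; lra.
have : 0 <= X * (1 - X) by apply: mulr_ge0; lra.
rewrite /S in S0 S1 * => ? ?.
have : (y0 + y) * (X ^+ 2 + Y ^+ 2) <= 1 * (X ^+ 2 + Y ^+ 2) by apply: ler_wpM2r => //; lra.
lra.
Qed.

(** The minimum of x and 1 - x, so that [height_bounds] reads y <= (2 - k) * tent x. *)
Definition tent (R : realFieldType) (x : R) : R := if x <= 1/2 then x else 1 - x.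

Lemma tent_bounds (R : realFieldType) (x : R) : 0 <= x -> x <= 1 ->
  [/\ 0 <= tent x, tent x <= 1/2, tent x <= x & tent x <= 1 - x].
Proof. by rewrite /tent; case: (leP x (1/2)) => ? ? ?; split; lra. Qed.

(** Here l = 2 - sqrt 3, and 1 + l^2 = 4 l turns x^2 + (l tent x)^2 into 4 l x^2 for x <= 1/2. With
    x <= X, the form is at most v - v^2, where v = 4 l x X if X <= 1/2 and v = 2 l x if x <= 1/2 <
    X; this increases up to v = l. Beyond 1/2 both factors of the product are at least l. *)
Lemma tent_form_le (R : realFieldType) (l x X : R) :
  0 < l -> l < 3/10 -> l ^+ 2 = 4 * l - 1 -> 0 <= x -> x <= 1 -> 0 <= X -> X <= 1 ->
  2 * (x * (l * tent X) + X * (l * tent x)) -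
  (x ^+ 2 + (l * tent x) ^+ 2) * (X ^+ 2 + (l * tent X) ^+ 2) <= l - l ^+ 2.
Proof.
move=> l0 l3 lE.
wlog xX : x X / x <= X.
  move=> H x0 x1 X0 X1; case: (leP x X) => h; first exact: H.
  apply: le_trans (H X x (ltW h) X0 X1 x0 x1); rewrite le_eqVlt; apply/orP; left.
  by apply/eqP; ring.
move=> x0 x1 X0 X1.
have f1 (z : R) : z <= 1/2 -> z ^+ 2 + (l * tent z) ^+ 2 = 4 * l * z ^+ 2.
  by move=> h; rewrite /tent h exprMn lE; ring.
have f2 z : 1/2 < z -> z <= 1 -> l <= z ^+ 2 + (l * tent z) ^+ 2.
  move=> h z1; rewrite /tent (leNgt z) h /= exprMn lE.
  rewrite -subr_ge0 (_ : _ - _ = (2 * z - 1) * (2 * (l * z) - 3 * l + 1)); last by field.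
  have : 0 <= l * z by apply: mulr_ge0; lra.
  by move=> ?; apply: mulr_ge0; lra.
have q v : v <= l -> v - v ^+ 2 <= l - l ^+ 2.
  move=> ?; rewrite -subr_ge0 (_ : _ - _ = (l - v) * (1 - l - v)); last by ring.
  by apply: mulr_ge0; lra.
have [xh|xh] := leP x (1/2); have [Xh|Xh] := leP X (1/2).
- rewrite !f1 // /tent xh Xh.
  rewrite (_ : _ - _ = l * (4 * (x * X)) - (l * (4 * (x * X))) ^+ 2); last by ring.
  apply: q; rewrite ler_piMr; [by []|exact: ltW|].
  have : x * X <= 1/2 * (1/2) by apply: ler_pM.
  lra.
- rewrite f1 // {1 2}/tent xh (leNgt X) Xh /=.
  apply: (@le_trans _ _ (l * (2 * x) - (l * (2 * x)) ^+ 2)); last first.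
    by apply: q; rewrite ler_piMr; [|exact: ltW|lra].
  rewrite (_ : 2 * _ = l * (2 * x)); last by ring.
  rewrite lerD2l lerN2.
  rewrite (_ : (l * (2 * x)) ^+ 2 = 4 * l * x ^+ 2 * l); last by ring.
  rewrite ler_wpM2l //; last by apply: f2.
  by rewrite mulr_ge0 ?sqr_ge0//; lra.
- by move: (le_lt_trans (le_trans xX Xh) xh); rewrite ltxx.
- have fx := f2 x xh x1; have fX := f2 X Xh X1.
  rewrite {1 2}/tent (leNgt x) (leNgt X) xh Xh /=.
  apply: lerB.
    rewrite (_ : 2 * _ = l * (1 - (2 * x - 1) * (2 * X - 1))); last by ring.
    rewrite ler_piMr; [by []|exact: ltW|].
    have : 0 <= (2 * x - 1) * (2 * X - 1) by apply: mulr_ge0; lra.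
    lra.
  by rewrite expr2 ler_pM //; exact: ltW.
Qed.

(** By [skew_form_mono] the form does not decrease when y, then Y, is raised to its bound from
    [height_bounds]; what remains is [tent_form_le] with l = 2 - k. When xY + yX = Re (ab), the form
    is 1 - |1 - ab|^2. *)
Lemma skew_form_le (R : realFieldType) (k x y X Y : R) :
  0 < k -> k ^+ 2 = 3 ->
  y <= x -> - x <= y -> x ^+ 2 + y ^+ 2 <= 1 ->
  Y <= X -> - X <= Y -> X ^+ 2 + Y ^+ 2 <= 1 ->
  2 * y <= x ^+ 2 + y ^+ 2 -> 2 * (x + y) <= 1 + (x ^+ 2 + y ^+ 2) ->
  2 * Y <= X ^+ 2 + Y ^+ 2 -> 2 * (X + Y) <= 1 + (X ^+ 2 + Y ^+ 2) ->
  2 * (x * Y + X * y) - (x ^+ 2 + y ^+ 2) * (X ^+ 2 + Y ^+ 2) <= 3 * k - 5.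
Proof.
move=> k0 k3 yx xy s1 YX XY S1 h1 h2 h3 h4.
have [l1 l2] := height_bounds k0 k3 yx xy s1 h1 h2.
have [L1 L2] := height_bounds k0 k3 YX XY S1 h3 h4.
have k2 : k < 2 by rewrite ltNge; apply/negP => ?; nra.
have k17 : 17/10 < k by rewrite ltNge; apply/negP => ?; nra.
have x1 : x <= 1 by rewrite leNgt; apply/negP => ?; nra.
have X1 : X <= 1 by rewrite leNgt; apply/negP => ?; nra.
set l := 2 - k in l1 l2 L1 L2.
have lE : l ^+ 2 = 4 * l - 1 by rewrite /l; clear -k3; lra.
have l0 : 0 < l by rewrite /l; clear -k2; lra.
have l3 : l < 3/10 by rewrite /l; clear -k17; lra.
have -> : 3 * k - 5 = l - l ^+ 2 by rewrite lE /l; ring.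
have ym : y <= l * tent x by rewrite /tent; case: ifP.
have Ym : Y <= l * tent X by rewrite /tent; case: ifP.
have x0 : 0 <= x by clear -yx xy; lra.
have X0 : 0 <= X by clear -YX XY; lra.
clear l1 l2 L1 L2 h1 h2 h3 h4 k2 k17 k0 k3.
have [m0 m1 mx mx'] := tent_bounds x0 x1.
have [M0 M1 MX _] := tent_bounds X0 X1.
have tl (m : R) : 0 <= m -> l * m <= m by move=> ?; rewrite ler_piMl//; clear -l3; lra.
have lm : 0 <= l * tent x by rewrite mulr_ge0 // ltW.
have sm : x ^+ 2 + (l * tent x) ^+ 2 <= 1.
  have : (l * tent x) ^+ 2 <= tent x ^+ 2 by rewrite ler_sqr ?nnegrE// tl.
  have : tent x ^+ 2 <= x * (1 - x) by rewrite expr2 ler_pM.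
  clear -x1; lra.
have lh (m : R) : 0 <= m -> m <= 1/2 -> l * m <= 1/2 by move=> ? ?; apply: le_trans (tl _ _) _.
have e (a b c d : R) : 2 * (a * d + c * b) - (a ^+ 2 + b ^+ 2) * (c ^+ 2 + d ^+ 2) =
  2 * (c * b + a * d) - (c ^+ 2 + d ^+ 2) * (a ^+ 2 + b ^+ 2) by ring.
apply: le_trans (skew_form_mono x0 x1 X0 XY YX S1 ym (lh _ m0 m1)) _.
rewrite e; apply: le_trans (skew_form_mono X0 X1 x0 _ _ sm Ym (lh _ M0 M1)) _.
- by apply: le_trans lm; rewrite oppr_le0.
- exact: le_trans (tl _ m0) mx.
rewrite -e; exact: tent_form_le.
Qed.

(** The sector |y| <= x of the unit disc lies inside the unit disc centred at (1, 0), and touches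
    its boundary circle only at the origin. *)
Lemma sector_eq0 (R : realFieldType) (x y : R) :
  y <= x -> - x <= y -> x ^+ 2 + y ^+ 2 <= 1 -> 2 * x <= x ^+ 2 + y ^+ 2 -> x = 0 /\ y = 0.
Proof.
move=> yx xy s1 h.
have x1 : x <= 1 by rewrite leNgt; apply/negP => ?; nra.
have h1 : 0 <= (x - y) * (x + y) by apply: mulr_ge0; lra.
have h2 : 0 <= x * (1 - x) by apply: mulr_ge0; lra.
have /eqP : x * (1 - x) = 0 by lra.
rewrite mulf_eq0 => /orP[/eqP x0|/eqP x0].
  by split=> //; lra.
have y1 : y ^+ 2 = 0 by apply/eqP; rewrite eq_le sqr_ge0 andbT; lra.
exfalso; lra.
Qed.

(* If A = x + iy and B = Y + iX, then xY + yX is the scalar product of A and B. *)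
Lemma sector_dot_le (R : realFieldType) (k x y X Y : R) :
  0 < k -> k ^+ 2 = 3 ->
  y <= x -> - x <= y -> x ^+ 2 + y ^+ 2 <= 1 ->
  Y <= X -> - X <= Y -> X ^+ 2 + Y ^+ 2 <= 1 ->
  2 * x <= x ^+ 2 + y ^+ 2 \/ 2 * Y <= X ^+ 2 + Y ^+ 2 ->
  2 * y <= x ^+ 2 + y ^+ 2 \/ 2 * X <= X ^+ 2 + Y ^+ 2 ->
  x + y <= x ^+ 2 + y ^+ 2 \/ 2 * (X + Y) <= 1 + (X ^+ 2 + Y ^+ 2) ->
  X + Y <= X ^+ 2 + Y ^+ 2 \/ 2 * (x + y) <= 1 + (x ^+ 2 + y ^+ 2) ->
  2 * (x * Y + X * y) - (x ^+ 2 + y ^+ 2) * (X ^+ 2 + Y ^+ 2) <= 3 * k - 5.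
Proof.
move=> k0 k3.
have k53 : 5 < 3 * k by rewrite ltNge; apply/negP => ?; nra.
move=> yx xy s1 YX XY S1 c1 c2 c3 c4.
(* In the sector, x + y <= x^2 + y^2 forces y <= 0, which makes the form nonpositive, while 3k - 5 >
   0. *)
have key : forall x y X Y : R, y <= x -> - x <= y -> x ^+ 2 + y ^+ 2 <= 1 ->
    Y <= X -> - X <= Y -> X ^+ 2 + Y ^+ 2 <= 1 -> 2 * Y <= X ^+ 2 + Y ^+ 2 ->
    x + y <= x ^+ 2 + y ^+ 2 ->
    2 * (x * Y + X * y) - (x ^+ 2 + y ^+ 2) * (X ^+ 2 + Y ^+ 2) <= 0.
  clear; move=> x y X Y yx xy s1 YX XY S1 h1 h2.
  have x1 : x <= 1 by rewrite leNgt; apply/negP => ?; nra.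
  have y0 : y <= 0.
    rewrite leNgt; apply/negP => y0.
    have : 0 <= x * (1 - x) by apply: mulr_ge0; lra.
    have : 0 < y * (1 - y).
      by apply: mulr_gt0 => //; rewrite ltNge; apply/negP => ?; nra.
    lra.
  have : x * (2 * Y) <= x * (X ^+ 2 + Y ^+ 2) by apply: ler_wpM2l => //; lra.
  have S0 : 0 <= X ^+ 2 + Y ^+ 2 by rewrite addr_ge0 ?sqr_ge0.
  have X1 : X <= 1 by rewrite leNgt; apply/negP => ?; nra.
  have SX : X ^+ 2 + Y ^+ 2 <= 2 * X.
    have : 0 <= (X - Y) * (X + Y) by apply: mulr_ge0; lra.
    have : 0 <= X * (1 - X) by apply: mulr_ge0; lra.
    lra.
  have : (x + y) * (X ^+ 2 + Y ^+ 2) <= (x ^+ 2 + y ^+ 2) * (X ^+ 2 + Y ^+ 2).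
    exact: ler_wpM2r.
  have : 0 <= (- y) * (2 * X - (X ^+ 2 + Y ^+ 2)) by apply: mulr_ge0; lra.
  lra.
have [x0|x0] := boolP ((x == 0) && (y == 0)).
  by case/andP: x0 => /eqP -> /eqP ->; lra.
have [X0|X0] := boolP ((X == 0) && (Y == 0)).
  by case/andP: X0 => /eqP -> /eqP ->; lra.
(* By [sector_eq0] the other alternative holds only for the zero vector. *)
have h2 : 2 * Y <= X ^+ 2 + Y ^+ 2.
  case: c1 => // h; case: (@sector_eq0 _ x y) => // ? ?; move: x0; subst; by rewrite eqxx.
have h1 : 2 * y <= x ^+ 2 + y ^+ 2.
  case: c2 => // h; case: (@sector_eq0 _ X Y) => // ? ?; move: X0; subst; by rewrite eqxx.
case: c3 => [c3|c3].
  by apply: le_trans (key _ _ _ _ _ _ _ _ _ _ _ c3) _ => //; clear -k53; lra.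
case: c4 => [c4|c4].
  have := key _ _ _ _ YX XY S1 yx xy s1 h1 c4; clear -k53; lra.
exact: skew_form_le.
Qed.

Lemma unit_signP (R : realFieldType) (x : R) : exists e : R, e ^+ 2 = 1 /\ e * x = `|x|.
Proof.
case: (ger0P x) => h; [exists 1|exists (-1)].
  by split; [exact: expr1n|exact: mul1r].
by split; [rewrite sqrrN expr1n|exact: mulN1r].
Qed.

(** Exchanging coordinates gives |y| <= |x|, and signs can be chosen freely. If also |v| <= |u|,
    either the scalar product is nonpositive or [sector_eq0] makes a vector vanish; if |u| <= |v|,
    this is [sector_dot_le]. *)
Lemma dot_le (R : realFieldType) (k x y u v : R) (s := x ^+ 2 + y ^+ 2) (t := u ^+ 2 + v ^+ 2) :
  0 < k -> k ^+ 2 = 3 -> s <= 1 -> t <= 1 ->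
  (forall e, e ^+ 2 = 1 -> 2 * (e * x) <= s \/ 2 * (e * u) <= t) ->
  (forall e, e ^+ 2 = 1 -> 2 * (e * y) <= s \/ 2 * (e * v) <= t) ->
  (forall e f, e ^+ 2 = 1 -> f ^+ 2 = 1 ->
    e * x + f * y <= s \/ 2 * (e * u + f * v) <= 1 + t) ->
  (forall e f, e ^+ 2 = 1 -> f ^+ 2 = 1 ->
    e * u + f * v <= t \/ 2 * (e * x + f * y) <= 1 + s) ->
  2 * (x * u + y * v) - s * t <= 3 * k - 5.
Proof.
move=> k0 k3.
have k53 : 5 < 3 * k by rewrite ltNge; apply/negP => ?; nra.
rewrite {}/s {}/t.
wlog xy : x y u v / `|y| <= `|x|.
  move=> H s1 t1 h1 h2 h3 h4; have [|/ltW] := leP `|y| `|x| => [xy|]; first exact: (H x y u v xy).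
  move=> xy; move: (H y x v u xy).
  rewrite (addrC (y ^+ 2)) (addrC (v ^+ 2)) (addrC (y * v)) => {}H; apply: H => // e f e1 f1.
    by rewrite ![e * _ + _]addrC; exact: h3.
  by rewrite ![e * _ + _]addrC; exact: h4.
move=> s1 t1 h1 h2 h3 h4.
have [e [e1 ex]] := unit_signP x.
have eK (z : R) : e * (e * z) = z by rewrite mulrA -expr2 e1 mul1r.
have sq (g z : R) : g ^+ 2 = 1 -> (g * z) ^+ 2 = z ^+ 2 by move=> g1; rewrite exprMn g1 mul1r.
have e_norm (z : R) : `|e * z| = `|z|.
  by rewrite normrM; move/eqP: e1; rewrite sqrf_eq1 => /orP[] /eqP ->; rewrite ?normrN normr1 mul1r.
have st0 : 0 <= (x ^+ 2 + y ^+ 2) * (u ^+ 2 + v ^+ 2) by rewrite mulr_ge0 ?addr_ge0 ?sqr_ge0.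
have yl : y <= e * x by rewrite ex (le_trans (ler_norm _)).
have yl' : - (e * x) <= y by rewrite ex lerNl (le_trans (ler_norm _))// normrN.
have [uv|/ltW uv] := leP `|v| `|u|.
  have [eu|eu] := leP (e * u) 0.
    have h : `|y| * `|v| <= `|x| * `|u| by apply: ler_pM.
    have : x * u = - (`|x| * `|u|).
      by rewrite -ex -(e_norm u) (ler0_norm eu) mulrN opprK -[x in LHS]eK -[u in LHS]eK -!mulrA
        !eK mulrCA eK.
    have := ler_norm (y * v); rewrite normrM.
    clear -h k53 st0; lra.
  have eu' : e * u = `|u| by rewrite -(e_norm u) gtr0_norm.
  case: (h1 e e1) => h.
    have [x0 y0] : e * x = 0 /\ y = 0 by apply: sector_eq0; rewrite ?sq.
    by rewrite -(eK x) x0 y0; clear -k53; lra.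
  have [x0 y0] : e * u = 0 /\ v = 0.
    apply: sector_eq0; rewrite ?sq // eu'; first by rewrite (le_trans (ler_norm _)).
    by rewrite lerNl (le_trans (ler_norm _))// normrN.
  by rewrite -(eK u) x0 y0; clear -k53; lra.
have [f [f1 fv]] := unit_signP v.
have f_norm (z : R) : `|f * z| = `|z|.
  by rewrite normrM; move/eqP: f1; rewrite sqrf_eq1 => /orP[] /eqP ->; rewrite ?normrN normr1 mul1r.
have := @sector_dot_le R k (e * x) (f * y) (f * v) (e * u) k0 k3.
rewrite !sq //.
have -> : e * x * (e * u) + f * v * (f * y) = x * u + y * v.
  rewrite (_ : _ + _ = e ^+ 2 * (x * u) + f ^+ 2 * (y * v)); last by ring.
  by rewrite e1 f1 !mul1r.
have lN (a b : R) : `|a| <= b -> a <= b /\ - b <= a by rewrite ler_norml => /andP[].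
have [a1 a2] := lN (f * y) (e * x) ltac:(by rewrite f_norm ex).
have [a3 a4] := lN (e * u) (f * v) ltac:(by rewrite e_norm fv).
rewrite (addrC (v ^+ 2)) (addrC (f * v)) => H; apply: H => //;
  by [exact: h1|exact: h2|exact: h3|exact: h4].
Qed.

(** From (x - m)(y - m) >= 0 one gets x + y >= m + sqrt (1 - 2m - m^2). This is concave in m, hence
    above its chord between m = 0 and m = (k - 1)/2, the value at which x = y = m. *)
Lemma corner_sum_ge (R : realFieldType) (k x y m : R) :
  0 < k -> k ^+ 2 = 3 -> 0 <= m -> m <= x -> m <= y -> x ^+ 2 + y ^+ 2 = 1 - 2 * m ->
  1 - (k - 1) * m <= x + y /\ 2 * m <= k - 1.
Proof.
move=> k0 k3 m0 mx my s.
have k1 : 1 < k by rewrite ltNge; apply/negP => ?; nra.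
have xy0 : 0 <= (x - m) * (y - m) by apply: mulr_ge0; lra.
have mt : 2 * m <= k - 1.
  have : m ^+ 2 <= x ^+ 2 by rewrite ler_sqr ?nnegrE//; lra.
  have : m ^+ 2 <= y ^+ 2 by rewrite ler_sqr ?nnegrE//; lra.
  move=> ? ?; rewrite leNgt; apply/negP => h.
  have : 0 < (2 * m - (k - 1)) * (2 * m + (k + 1)) by apply: mulr_gt0; lra.
  lra.
split=> //; rewrite leNgt; apply/negP => h.
have h1 : 0 <= x + y - m by lra.
have h2 : x + y - m < 1 - k * m by lra.
have h3 : (x + y - m) ^+ 2 < (1 - k * m) ^+ 2 by rewrite ltr_sqr ?nnegrE//; lra.
have : 0 <= m * (2 * (k - 1) - 4 * m) by apply: mulr_ge0; lra.
have : (1 - k * m) ^+ 2 = 1 - 2 * (k * m) + 3 * m ^+ 2 by rewrite -k3; ring.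
lra.
Qed.

(** Put m = (1 - s)/2, n = (1 - t)/2. Since m, n > 0, the conditions for e and -e leave one sign per
    coordinate that makes both vectors at least m and n there. Expanding (X - m)(U - n) >= 0 and (Y
    - m)(V - n) >= 0 with [corner_sum_ge] bounds the form below by 2 - 4 (k - 1) m n, and 2m, 2n <=
    k - 1. *)
Lemma corner_form_ge (R : realFieldType) (k x y u v : R) (s := x ^+ 2 + y ^+ 2) (t := u ^+ 2 +
  v ^+ 2) :
  0 < k -> k ^+ 2 = 3 -> s < 1 -> t < 1 ->
  (forall e, e ^+ 2 = 1 -> 1 - s <= 2 * (e * x) \/ 1 - t <= - (2 * (e * u))) ->
  (forall e, e ^+ 2 = 1 -> 1 - s <= 2 * (e * y) \/ 1 - t <= - (2 * (e * v))) ->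
  12 - 6 * k <= 1 + 2 * (x * u + y * v) + s * t.
Proof.
move=> k0 k3 s1 t1 h1 h2.
have sgn (a b : R) : (forall e, e ^+ 2 = 1 -> 1 - s <= 2 * (e * a) \/ 1 - t <= - (2 * (e * b))) ->
    exists e, [/\ e ^+ 2 = 1, 1 - s <= 2 * (e * a) & 1 - t <= 2 * (e * b)].
  move=> h; have := h 1 (expr1n _ _); have := h (-1).
  rewrite sqrrN expr1n => /(_ erefl).
  case=> ?; case=> ?; try (exfalso; lra).
    by exists (-1); split; [rewrite sqrrN expr1n| |]; lra.
  by exists 1; split; [rewrite expr1n| |]; lra.
have [e [e1 ex eu]] := sgn _ _ h1; have [f [f1 fy fv]] := sgn _ _ h2.
have sq (g z : R) : g ^+ 2 = 1 -> (g * z) ^+ 2 = z ^+ 2 by move=> g1; rewrite exprMn g1 mul1r.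
have [S mS] : 1 - (k - 1) * ((1 - s) / 2) <= e * x + f * y /\ 2 * ((1 - s) / 2) <= k - 1.
  by apply: corner_sum_ge => //; rewrite ?sq // -/s; lra.
have [T mT] : 1 - (k - 1) * ((1 - t) / 2) <= e * u + f * v /\ 2 * ((1 - t) / 2) <= k - 1.
  by apply: corner_sum_ge => //; rewrite ?sq // -/t; lra.
have -> : x * u + y * v = (e * x) * (e * u) + (f * y) * (f * v).
  rewrite (_ : _ * _ * _ + _ = e ^+ 2 * (x * u) + f ^+ 2 * (y * v)); last by ring.
  by rewrite e1 f1 !mul1r.
have := erefl ((1 - s) / 2); move: {2}((1 - s) / 2) => m mE.
have := erefl ((1 - t) / 2); move: {2}((1 - t) / 2) => n nE.
move: (e * x) (f * y) (e * u) (f * v) ex fy eu fv S T => X Y U V ex fy eu fv S T.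
have -> : s = 1 - 2 * m by lra.
have -> : t = 1 - 2 * n by lra.
rewrite mE in S mS; rewrite nE in T mT.
have m0 : 0 < m by lra.
have n0 : 0 < n by lra.
have mX : m <= X by lra.
have mY : m <= Y by lra.
have nU : n <= U by lra.
have nV : n <= V by lra.
clear -k0 k3 S T m0 n0 mS mT mX mY nU nV.
have p1 : 0 <= (X - m) * (U - n) by apply: mulr_ge0; lra.
have p2 : 0 <= (Y - m) * (V - n) by apply: mulr_ge0; lra.
have p3 : m * (1 - (k - 1) * n) <= m * (U + V) by apply: ler_wpM2l => //; lra.
have p4 : n * (1 - (k - 1) * m) <= n * (X + Y) by apply: ler_wpM2l => //; lra.
have k1 : 1 < k by rewrite ltNge; apply/negP => ?; nra.
have p5 : (2 * m) * (2 * n) * (k - 1) <= (k - 1) * (k - 1) * (k - 1).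
  by apply: ler_wpM2r; [lra|apply: ler_pM => //; lra].
have p6 : k ^+ 3 = 3 * k by rewrite exprSr k3.
lra.
Qed.

(** * Gaussian integers *)

Section Modulus.
Variable R : realType.
Implicit Types (z w : R[i]) (x y : R).

Definition nsq z : R := (Re z) ^+ 2 + (Im z) ^+ 2.

Lemma normr_normc z : `|z| = (normc z)%:C.
Proof. by []. Qed.

Lemma normc_ge0 z : 0 <= normc z.
Proof. by case: z => a b; exact: sqrtr_ge0. Qed.

Lemma normc_sqr z : normc z ^+ 2 = nsq z.
Proof. by case: z => a b; rewrite /normc sqr_sqrtr // addr_ge0 ?sqr_ge0. Qed.

Lemma nsq_ge0 z : 0 <= nsq z.
Proof. by rewrite addr_ge0 ?sqr_ge0. Qed.

Lemma nsqM z w : nsq (z * w) = nsq z * nsq w.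
Proof. by rewrite -!normc_sqr normcM exprMn. Qed.

Lemma nsqV z : nsq z^-1 = (nsq z)^-1.
Proof. by rewrite -!normc_sqr normcV exprVn. Qed.

Lemma normc_eq0 z : (normc z == 0) = (z == 0).
Proof. by apply/eqP/eqP => [/eq0_normc|->] //; exact: normc0. Qed.

Lemma normc_gt0 z : (0 < normc z) = (z != 0).
Proof. by rewrite lt_neqAle normc_ge0 andbT eq_sym normc_eq0. Qed.

Lemma ltr_normc z w : (normc z < normc w) = (nsq z < nsq w).
Proof. by rewrite -!normc_sqr ltr_sqr ?nnegrE ?normc_ge0. Qed.

Lemma ler_normc z w : (normc z <= normc w) = (nsq z <= nsq w).
Proof. by rewrite -!normc_sqr ler_sqr ?nnegrE ?normc_ge0. Qed.

Lemma normc_le1 z : (normc z <= 1) = (nsq z <= 1).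
Proof. by rewrite -!normc_sqr expr_le1 ?normc_ge0. Qed.

Lemma normc_lt1 z : (normc z < 1) = (nsq z < 1).
Proof. by rewrite -!normc_sqr expr_lt1 ?normc_ge0. Qed.

Lemma normcB z w : normc (z - w) <= normc z + normc w.
Proof. by rewrite -[normc w]normcN; exact: le_normcD. Qed.

Lemma normc_distC z w : normc (z - w) = normc (w - z).
Proof. by rewrite -normcN opprB. Qed.

Lemma normc_leB z w : normc z - normc w <= normc (z - w).
Proof. by rewrite lerBlDr -{1}(subrK w z) le_normcD. Qed.

Lemma normc_div z w : normc (z / w) = normc z / normc w.
Proof. by rewrite normcM normcV. Qed.

End Modulus.

Section GaussianIntegers.
Variable R : realType.
Local Notation G := (@gaussian_integers R).
Implicit Types (p q z : R[i]).

Lemma gauss0 : G 0.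
Proof. by exists 0, 0. Qed.

Lemma gauss1 : G 1.
Proof. by exists 1, 0. Qed.

Lemma gaussD p q : G p -> G q -> G (p + q).
Proof.
by move=> [a [b ->]] [c [d ->]]; exists (a + c), (b + d); rewrite !intrD.
Qed.

Lemma gaussN p : G p -> G (- p).
Proof. by move=> [a [b ->]]; exists (- a), (- b); rewrite !mulrNz. Qed.

Lemma gaussB p q : G p -> G q -> G (p - q).
Proof. by move=> ? ?; apply: gaussD => //; exact: gaussN. Qed.

Lemma gaussM p q : G p -> G q -> G (p * q).
Proof.
move=> [a [b ->]] [c [d ->]]; exists (a * c - b * d), (a * d + b * c).
by rewrite !intrD !mulrNz !intrM.
Qed.

Lemma nsq_gauss p : G p -> exists n : nat, nsq p = n%:R.
Proof.
move=> [a [b ->]]; exists (absz (a ^+ 2 + b ^+ 2)%R).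
by rewrite /nsq /= natr_absz ger0_norm ?addr_ge0 ?sqr_ge0// rmorphD !rmorphXn.
Qed.

Lemma nsq_gauss_ge1 p : G p -> p != 0 -> 1 <= nsq p.
Proof.
move=> Gp p0; have [n pn] := nsq_gauss Gp; rewrite pn ler1n lt0n.
apply: contra p0 => /eqP n0; rewrite -normc_eq0 -sqrf_eq0 normc_sqr pn n0//.
Qed.

Lemma normc_gauss_ge1 p : G p -> p != 0 -> 1 <= normc p.
Proof.
by move=> Gp p0; rewrite -[1](@normc1 R) ler_normc (le_trans _ (nsq_gauss_ge1 Gp p0))// /nsq
  expr1n expr0n addr0.
Qed.

Lemma round_int (x : R) : exists m : int, `|x - m%:~R| <= 1/2.
Proof.
exists (Num.floor (x + 1/2)); have := floor_le (x + 1/2).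
have := floorD1_gt (x + 1/2); rewrite intrD => ? ?; rewrite ler_norml.
by apply/andP; split; lra.
Qed.

Lemma round_gauss z : exists p, [/\ G p, `|Re (z - p)| <= 1/2 & `|Im (z - p)| <= 1/2].
Proof.
case: z => x y; have [m hm] := round_int x; have [n hn] := round_int y.
by exists (m%:~R +i* n%:~R); split; [exists m, n|exact: hm|exact: hn].
Qed.

Lemma nsq_le_half z : `|Re z| <= 1/2 -> `|Im z| <= 1/2 -> nsq z <= 1/2.
Proof.
rewrite /nsq -(real_normK (num_real (Re z))) -(real_normK (num_real (Im z))).
move=> h1 h2.
have : `|Re z| ^+ 2 <= (1/2) ^+ 2 by rewrite ler_sqr ?nnegrE//; lra.
have : `|Im z| ^+ 2 <= (1/2) ^+ 2 by rewrite ler_sqr ?nnegrE//; lra.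
lra.
Qed.

Lemma gauss_divmod p q : G p -> G q -> q != 0 ->
  exists k, G k /\ nsq (p - k * q) <= nsq q / 2.
Proof.
move=> Gp Gq q0; have [k [Gk h1 h2]] := round_gauss (p / q).
exists k; split => //; have := nsq_le_half h1 h2.
have -> : p - k * q = (p / q - k) * q by rewrite mulrBl divfK.
by rewrite nsqM => h; rewrite mulrC ler_wpM2l ?nsq_ge0//; lra.
Qed.

(** Euclid's algorithm: the squared modulus of the remainder is at most half that of the divisor. *)
Lemma gauss_bezout p q : G p -> G q -> ~ (p = 0 /\ q = 0) ->
  exists d u v p' q', [/\ [/\ G d, G u, G v, G p' & G q'], d != 0,
    p = d * p', q = d * q' & u * p' + v * q' = 1].
Proof.
move=> Gp Gq; have [n] := nsq_gauss Gq.
elim/ltn_ind: n p q Gp Gq => n IH p q Gp Gq qn pq0.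
have [q0|q0] := eqVneq q 0.
  exists p, 1, 0, 1, 0; rewrite q0 !mulr1 !mulr0 addr0; split=> //.
    by split=> //; [exact: gauss1|exact: gauss0|exact: gauss1|exact: gauss0].
  by apply/eqP => p0; apply: pq0.
have [k [Gk hk]] := gauss_divmod Gp Gq q0.
have Gr : G (p - k * q) by apply: gaussB => //; exact: gaussM.
have [m rm] := nsq_gauss Gr.
have mn : (m < n)%N.
  have := nsq_gauss_ge1 Gq q0; rewrite -(ltr_nat R) -rm -qn; lra.
have [] := IH m mn q _ Gq Gr rm; first by case=> q0'; rewrite q0' eqxx in q0.
move=> d [u [v [q' [r' [[Gd Gu Gv Gq' Gr'] d0 qE rE uv]]]]].
exists d, v, (u - v * k), (k * q' + r'), q'; split=> //.
- split=> //; first by apply: gaussB => //; exact: gaussM.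
  by apply: gaussD => //; exact: gaussM.
- by rewrite mulrDr -rE mulrCA -qE addrC subrK.
- by rewrite -uv; ring.
Qed.

End GaussianIntegers.

(** * The determinant of a pair of minimal vectors *)

(** Used with a + ib = kap * conj D, n = |D|^2, K = |kap|^2. Let h be the integral part of n/2.
    Unless |a| = |b| = n/2, the sum of squares is less than n h, so K <= h - 1. *)
Lemma int_residue_small (a b K n : int) : 3 <= n ->
  `|2 * a| <= n -> `|2 * b| <= n -> a ^+ 2 + b ^+ 2 = n * K ->
  `|2 * a| = n /\ `|2 * b| = n \/ 2 * K <= n - 2.
Proof.
move=> n3 an bn abK.
have sq (c h : int) : `|c| <= h -> c ^+ 2 <= h ^+ 2.
  by move=> ch; rewrite -(real_normK (num_real c)) ler_sqr ?nnegrE// (le_trans _ ch).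
have [h [hE|hE]] : exists h : int, n = 2 * h + 1 \/ n = 2 * h.
  by exists (n %/ 2)%Z; have := divz_eq n 2; have := modz_ge0 n (d := 2) isT;
    have := @ltz_mod n 2 isT; lia.
- right; have ah := sq a h ltac:(lia); have bh := sq b h ltac:(lia).
  suff : K <= h - 1 by lia.
  rewrite leNgt; apply/negP => hK.
  have : n * h <= n * K by apply: ler_wpM2l; lia.
  rewrite -abK hE mulrDl -mulrA -expr2; lia.
- have [?|c] : (`|a| = h /\ `|b| = h) \/ (`|a| <= h - 1 /\ `|b| <= h \/ `|b| <= h - 1 /\ `|a|
  <= h) by lia.
    by left; lia.
  right; have : a ^+ 2 + b ^+ 2 <= h ^+ 2 + (h - 1) ^+ 2.
    by case: c => -[/sq h1 /sq h2]; lia.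
  move=> ?; suff : K <= h - 1 by lia.
  rewrite leNgt; apply/negP => hK.
  have : n * h <= n * K by apply: ler_wpM2l; lia.
  rewrite -abK hE -mulrA -expr2; lia.
Qed.

Lemma int_sqr_sum1 (a b : int) : a ^+ 2 + b ^+ 2 = 1 ->
  (a = 0 /\ `|b| = 1) \/ (b = 0 /\ `|a| = 1).
Proof.
have sq1 (c : int) : c ^+ 2 = 1 -> `|c| = 1.
  by move=> /eqP; rewrite sqrf_eq1 => /orP[] /eqP ->.
move=> h; have b2 := sqr_ge0 b.
have [a0|a0] := eqVneq a 0.
  by left; split=> //; apply: sq1; rewrite -h a0 expr0n add0r.
have : 0 < a ^+ 2 by rewrite lt_neqAle sqr_ge0 eq_sym sqrf_eq0 a0.
move=> a3; have /eqP : b ^+ 2 = 0 by lia.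
by rewrite sqrf_eq0 => /eqP b0; right; split=> //; apply: sq1; rewrite -h b0 expr0n addr0.
Qed.

Lemma int_sqr_sum2 (a b : int) : a ^+ 2 + b ^+ 2 = 2 -> `|a| = 1 /\ `|b| = 1.
Proof.
suff H : forall c d : int, c ^+ 2 + d ^+ 2 = 2 -> `|c| = 1.
  by move=> h; split; [exact: H h|apply: (H b a); rewrite addrC].
move=> c d; have sqE (e : int) : e ^+ 2 = `|e| * `|e| by rewrite -expr2 (real_normK (num_real e)).
rewrite !sqE; move: `|c| `|d| (normr_ge0 c) (normr_ge0 d) => x y x0 y0 h.
have : (x < 2) by rewrite ltNge; apply/negP => ?; nia.
have : (y < 2) by rewrite ltNge; apply/negP => ?; nia.
have [x1|x1] : x = 0 \/ 1 <= x by lia.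
  by move: h; rewrite x1 mul0r add0r; nia.
lia.
Qed.

Section MinimalPair.
Variable R : realType.
Local Notation G := (@gaussian_integers R).
Implicit Types (p q z a b : R[i]).

Lemma gauss_residue_small D kap (rho : R[i]) : G D -> G kap -> kap = rho * D ->
  `|Re rho| <= 1/2 -> `|Im rho| <= 1/2 -> 3 <= nsq D ->
  (`|Re rho| = 1/2 /\ `|Im rho| = 1/2) \/ 2 * nsq kap <= nsq D - 2.
Proof.
move=> [d1 [d2 ->]] [c1 [c2 ->]]; case: rho => r1 r2 [] e1 e2 /= h1 h2.
pose n : int := d1 ^+ 2 + d2 ^+ 2; pose K : int := c1 ^+ 2 + c2 ^+ 2.
have nE : nsq (d1%:~R +i* d2%:~R : R[i]) = n%:~R by rewrite /nsq /= rmorphD !rmorphXn.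
have KE : nsq (c1%:~R +i* c2%:~R : R[i]) = K%:~R by rewrite /nsq /= rmorphD !rmorphXn.
rewrite nE KE => n3.
have n0 : 0 < n%:~R :> R by lra.
(* Real and imaginary parts of 2 kap conj D = 2 rho |D|^2. *)
have aE : (2 * (c1 * d1 + c2 * d2))%:~R = 2 * r1 * n%:~R :> R.
  by rewrite /n !(rmorphD, rmorphM, rmorphXn) /= e1 e2; ring.
have bE : (2 * (c2 * d1 - c1 * d2))%:~R = 2 * r2 * n%:~R :> R.
  by rewrite /n !(rmorphB, rmorphD, rmorphM, rmorphXn) /= e1 e2; ring.
have := @int_residue_small (c1 * d1 + c2 * d2) (c2 * d1 - c1 * d2) K n.
rewrite -!(ler_int R) !intr_norm aE bE !normrM !(ger0_norm (ltW n0)) (ger0_norm (ler0n R 2)).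
case => //; try by [rewrite ler_piMl //; [exact: ltW|lra]].
- by rewrite /n /K; ring.
- have half (c : int) (r : R) : c%:~R = 2 * r * n%:~R :> R -> `|c| = n -> `|r| = 1/2.
    move=> cE cn; have : `|2 * r * n%:~R| = n%:~R by rewrite -cE -intr_norm cn.
    rewrite !normrM (ger0_norm (ltW n0)) (ger0_norm (ler0n R 2)).
    by move=> /(canRL (mulfK (lt0r_neq0 n0))); rewrite divff ?lt0r_neq0 //; lra.
  by rewrite -!normrM => -[g1 g2]; left; split; [exact: half aE g1|exact: half bE g2].
- rewrite rmorphB rmorphM /= => ?; right; lra.
Qed.


Lemma sqr_eq1P (e : R) : e ^+ 2 = 1 -> e = 1 \/ e = -1.
Proof. by move/eqP; rewrite sqrf_eq1 => /orP[] /eqP; [left|right]. Qed.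

(** D is associate to 1 + i, modulo which all units are congruent. Concretely, parity shows that (p
    - q) conj D is divisible by 2. *)
Lemma gauss_unit_diff_dvd p q D : G p -> G q -> G D ->
  nsq p = 1 -> nsq q = 1 -> nsq D = 2 -> G ((p - q) / D).
Proof.
move=> [p1 [p2 ->]] [q1 [q2 ->]] [d1 [d2 ->]].
have nE (m n : int) : nsq (m%:~R +i* n%:~R : R[i]) = (m ^+ 2 + n ^+ 2)%:~R.
  by rewrite /nsq /= rmorphD !rmorphXn.
rewrite !nE => hp hq hd.
have p1E : p1 ^+ 2 + p2 ^+ 2 = 1 by apply: (@intr_inj R).
have q1E : q1 ^+ 2 + q2 ^+ 2 = 1 by apply: (@intr_inj R).
have d1E : d1 ^+ 2 + d2 ^+ 2 = 2 by apply: (@intr_inj R).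
have P := int_sqr_sum1 p1E; have Q := int_sqr_sum1 q1E; have [D1 D2] := int_sqr_sum2 d1E.
have odd1 (x : int) : `|x| = 1 -> exists h, x = 2 * h + 1.
  by move=> x1; exists (x %/ 2)%Z; clear -x1; lia.
have odd2 (x y : int) : (x = 0 /\ `|y| = 1) \/ (y = 0 /\ `|x| = 1) -> exists h, x + y = 2 * h + 1.
  by case=> -[-> /odd1[h ->]]; exists h; rewrite ?addr0 ?add0r.
have [x xE] := odd2 _ _ P; have [y yE] := odd2 _ _ Q.
have [h hE] : exists h, p1 - q1 + (p2 - q2) = 2 * h by exists (x - y); clear -xE yE; lia.
have [f fE] := odd1 _ D1; have [g gE] := odd1 _ D2; clear P Q D1 D2.
have [m mE] : exists m, (p1 - q1) * d1 + (p2 - q2) * d2 = 2 * m.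
  exists (h + (p1 - q1) * f + (p2 - q2) * g).
  by rewrite fE gE !mulrDr -hE; ring.
have [n nE'] : exists n, (p2 - q2) * d1 - (p1 - q1) * d2 = 2 * n.
  exists (h - (p1 - q1) + (p2 - q2) * f - (p1 - q1) * g).
  rewrite fE gE; clear -hE; rewrite !(mulrDr, mulrBr) -hE; ring.
exists m, n.
have D0 : d1%:~R +i* d2%:~R != 0 :> R[i].
  by apply/eqP => d0; move: hd; rewrite -nE d0 /nsq /=; lra.
apply: (mulIf D0); rewrite divfK //.
have e1 : 2 * (p1 - q1) = 2 * (m * d1 - n * d2).
  rewrite (_ : 2 * (m * d1 - n * d2) = 2 * m * d1 - 2 * n * d2); last by ring.
  by rewrite -mE -nE' -d1E; ring.
have e2 : 2 * (p2 - q2) = 2 * (m * d2 + n * d1).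
  rewrite (_ : 2 * (m * d2 + n * d1) = 2 * m * d2 + 2 * n * d1); last by ring.
  by rewrite -mE -nE' -d1E; ring.
clear -e1 e2 D0.
have {}e1 : p1 - q1 = m * d1 - n * d2 by lia.
have {}e2 : p2 - q2 = m * d2 + n * d1 by lia.
apply/eqP; rewrite eq_complex /= -!rmorphM -!rmorphB -rmorphD /= -e1 -e2 !rmorphB.
by rewrite !eqxx.
Qed.

Lemma unit_sign_gauss (e f : R) : e ^+ 2 = 1 -> f ^+ 2 = 1 ->
  [/\ G (e +i* f), G (e +i* 0) & G (0 +i* e)].
Proof.
have sg (x : R) : x ^+ 2 = 1 -> exists m : int, x = m%:~R.
  by move=> /eqP; rewrite sqrf_eq1 => /orP[] /eqP ->; [exists 1|exists (-1)].
move=> /sg[m ->] /sg[n ->]; split; by [exists m, n|exists m, 0|exists 0, m].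
Qed.

(* The lattice is spanned by (a, 1) and w = ((1 - kap a) / D, (b - kap) / D), so that it
   contains (1, b) = D w + kap (a, 1). *)
Lemma empty_box_det_ge (k : R) a b D kap :
  0 < k -> k ^+ 2 = 3 -> nsq a < 1 -> nsq b < 1 -> G D -> D != 0 -> G kap ->
  `|Re (kap / D)| <= 1/2 -> `|Im (kap / D)| <= 1/2 ->
  (forall s t, G s -> G t -> ~ (s = 0 /\ t = 0) ->
    1 <= nsq (s * a + t * ((1 - kap * a) / D)) \/ 1 <= nsq (s + t * ((b - kap) / D))) ->
  nsq D * (6 - 3 * k) <= nsq (1 - a * b).
Proof.
move=> k0 k3 a1 b1 GD D0 Gk h1 h2 box.
have Gi : G 'i by exists 0, 1.
have G1i : G (1 + 'i) by apply: gaussD => //; exact: gauss1.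
have n1i : nsq (1 + 'i : R[i]) = 2 by rewrite /nsq /= ; ring.
have i1 : 1 + 'i != 0 :> R[i] by apply/eqP => h; move: n1i; rewrite h /nsq /=; lra.
have D1 := nsq_gauss_ge1 GD D0.
have kE : kap = kap / D * D by rewrite divfK.
have nV (x : R[i]) : nsq (x / D) = nsq x / nsq D by rewrite nsqM nsqV.
have lt1 (x : R[i]) : nsq x < nsq D -> nsq (x / D) < 1.
  by move=> h; rewrite nV ltr_pdivrMr ?mul1r //; lra.
have [n nD] := nsq_gauss GD.
(* If |D|^2 >= 3 the box is not empty. When kap/D is a corner of the unit square, (1 + i) kap/D is a
   unit and the vector (1 + i)(1, b)/D lies in the box. *)
have [n3|n3] := leP 3 (nsq D).
  exfalso; have [[c1 c2]|c] := gauss_residue_small GD Gk kE h1 h2 n3.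
    have Gj : G ((1 + 'i) * (kap / D)).
      move: c1 c2; case: (kap / D) => x y /= c1 c2.
      have [xx|xx] : x = 1/2 \/ x = - (1/2) by move: c1; case: (ger0P x); lra.
        have [yy|yy] : y = 1/2 \/ y = - (1/2) by move: c2; case: (ger0P y); lra.
          by exists 0, 1; apply/eqP; rewrite eq_complex /= xx yy; apply/andP; split; apply/eqP;
            field.
        by exists 1, 0; apply/eqP; rewrite eq_complex /= xx yy; apply/andP; split; apply/eqP; field.
      have [yy|yy] : y = 1/2 \/ y = - (1/2) by move: c2; case: (ger0P y); lra.
        by exists (-1), 0; apply/eqP; rewrite eq_complex /= xx yy; apply/andP; split;
          apply/eqP; field.
      by exists 0, (-1); apply/eqP; rewrite eq_complex /= xx yy; apply/andP; split; apply/eqP;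
        field.
    case: (box _ _ Gj G1i).
    - by case=> _ /eqP; rewrite (negbTE i1).
    - rewrite [X in nsq X](_ : _ = (1 + 'i) / D); last by field.
      by rewrite leNgt lt1 // n1i; lra.
    - rewrite [X in nsq X](_ : _ = (1 + 'i) * b / D); last by field.
      rewrite leNgt lt1 // nsqM n1i; lra.
  (* From |kap|^2 <= |D|^2/2 - 1 <= (|D| - 1)^2; then w itself lies in the box. *)
  have kD : normc kap + 1 <= normc D.
    rewrite -lerBrDr -(ler_sqr) ?nnegrE ?normc_ge0 //; last first.
      rewrite subr_ge0 -(ler_sqr) ?nnegrE ?normc_ge0 // normc_sqr expr1n; lra.
    have : 0 <= (normc D - 2) ^+ 2 by exact: sqr_ge0.
    move: c; rewrite -!normc_sqr => ? ?; lra.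
  have na : normc a < 1 by rewrite normc_lt1.
  have nb : normc b < 1 by rewrite normc_lt1.
  have D3 : 1 < normc D.
    by rewrite -(ltr_sqr) ?nnegrE ?normc_ge0 // normc_sqr expr1n; lra.
  case: (box 0 1 (gauss0 R) (gauss1 R)).
  - by case=> _ /eqP; rewrite oner_eq0.
  - rewrite mul0r add0r mul1r leNgt lt1 // -ltr_normc.
    apply: le_lt_trans (normcB _ _) _; rewrite normc1 normcM.
    have [->|k00] := eqVneq kap 0; first by rewrite normc0 mul0r addr0.
    have : normc kap * normc a < normc kap * 1 by rewrite ltr_pM2l ?normc_gt0.
    lra.
  - rewrite add0r mul1r leNgt lt1 // -ltr_normc.
    by apply: le_lt_trans (normcB _ _) _; lra.
have n2 : (n < 3)%N by rewrite -(ltr_nat R) -nD.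
have : (0 < n)%N by rewrite -(ltr_nat R) -nD; lra.
case: n nD n2 => [//|[|[|//]]] nD _ _; rewrite nD.
(* For |D| = 1 the vectors (a, 1) and (1, b) already span the lattice. *)
- have box1 s t : G s -> G t -> ~ (s = 0 /\ t = 0) ->
      1 <= nsq (s * a + t) \/ 1 <= nsq (s + t * b).
    move=> Gs Gt st0; case: (box (s + t * kap) (t * D)).
    + by apply: gaussD => //; exact: gaussM.
    + exact: gaussM.
    + case=> h /eqP; rewrite mulf_eq0 (negbTE D0) orbF => /eqP t0.
      by apply: st0; move: h; rewrite t0 mul0r addr0.
    + by rewrite [X in nsq X](_ : _ = s * a + t); [left|field].
    + by rewrite [X in nsq X](_ : _ = s + t * b); [right|field].
  rewrite mul1r.
  have nz (s : R[i]) : ~ (1 = 0 :> R[i] /\ s = 0) by case=> /eqP; rewrite oner_eq0.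
  have nz' (s : R[i]) : ~ (s = 0 /\ 1 = 0 :> R[i]) by case=> _ /eqP; rewrite oner_eq0.
  move: a1 b1 box1; clear -k0 k3 nz nz'; case: a => a1 a2; case: b => b1 b2.
  move=> s1 t1 box; rewrite /nsq /= in s1 t1.
  (* The vectors -a and -conj b have scalar product Re (ab), and |1 - ab|^2 = 1 - 2 Re (ab) +
     |ab|^2. *)
  have := @dot_le R k (- a1) (- a2) (- b1) b2 k0 k3.
  rewrite !sqrrN => /(_ (ltW s1) (ltW t1)) H.
  have : 2 * (- a1 * - b1 + - a2 * b2) - (a1 ^+ 2 + a2 ^+ 2) * (b1 ^+ 2 + b2 ^+ 2) <= 3 * k - 5.
    apply: H => e.
    + move=> e1; have [_ Ge _] := unit_sign_gauss e1 e1.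
      by move: (box _ _ (gauss1 R) Ge (nz _)); case: (sqr_eq1P e1) => ->;
        rewrite /nsq /= => -[] ?; [left|right|left|right]; lra.
    + move=> e1; have [_ _ Ge] := unit_sign_gauss e1 e1.
      by move: (box _ _ (gauss1 R) Ge (nz _)); case: (sqr_eq1P e1) => ->;
        rewrite /nsq /= => -[] ?; [left|right|left|right]; lra.
    + move=> f e1 f1; have f1' : (- f) ^+ 2 = 1 by rewrite sqrrN.
      have [Ge _ _] := unit_sign_gauss e1 f1'.
      by move: (box _ _ Ge (gauss1 R) (nz' _)); case: (sqr_eq1P e1) => ->;
        case: (sqr_eq1P f1) => ->; rewrite /nsq /= => -[] ?;
        [left|right|left|right|left|right|left|right]; lra.
    + move=> f e1 f1.
      have [Ge _ _] := unit_sign_gauss e1 f1.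
      by move: (box _ _ (gauss1 R) Ge (nz _)); case: (sqr_eq1P e1) => ->;
        case: (sqr_eq1P f1) => ->; rewrite /nsq /= => -[] ?;
        [right|left|right|left|right|left|right|left]; lra.
  rewrite /nsq /=; lra.
(* For |D|^2 = 2 one has |kap|^2 <= 1, and kap = 0 would put w = (1/D, b/D) in the box. *)
- have k1 : nsq kap = 1.
    have kle : nsq kap <= 1.
      by rewrite kE nsqM nD; have := nsq_le_half h1 h2; lra.
    have [m km] := nsq_gauss Gk; rewrite km in kle *.
    have : (m <= 1)%N by rewrite -(ler_nat R).
    case: m km {kle} => [|[|//]] // km _; exfalso.
    have k00 : kap = 0 by apply/eqP; rewrite -normc_eq0 -sqrf_eq0 normc_sqr km.
    case: (box 0 1 (gauss0 R) (gauss1 R)).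
    + by case=> _ /eqP; rewrite oner_eq0.
    + rewrite k00 !mul0r subr0 add0r mul1r leNgt lt1 // nD /nsq /= expr1n expr0n /=; lra.
    + by rewrite k00 subr0 add0r mul1r leNgt lt1 // nD; lra.
  (* The vector w + ((kap - s)/D)(a, 1) equals ((1 - s a)/D, (b - s)/D). *)
  have box1 s : G s -> nsq s = 1 -> 2 <= nsq (1 - s * a) \/ 2 <= nsq (b - s).
    move=> Gs s1; have Gd := gauss_unit_diff_dvd Gk Gs GD k1 s1 nD.
    case: (box _ _ Gd (gauss1 R)).
    + by case=> _ /eqP; rewrite oner_eq0.
    + rewrite [X in nsq X](_ : _ = (1 - s * a) / D); last by field.
      by rewrite nV nD ler_pdivlMr // mul1r; left.
    + rewrite [X in nsq X](_ : _ = (b - s) / D); last by field.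
      by rewrite nV nD ler_pdivlMr // mul1r; right.
  move: a1 b1 box1; clear -k0 k3; case: a => a1 a2; case: b => b1 b2.
  move=> s1 t1 box; rewrite /nsq /= in s1 t1.
  have := @corner_form_ge R k a1 a2 (- b1) b2 k0 k3 s1.
  rewrite !sqrrN => /(_ t1) H.
  have : 12 - 6 * k <= 1 + 2 * (a1 * - b1 + a2 * b2) + (a1 ^+ 2 + a2 ^+ 2) * (b1 ^+ 2 + b2 ^+ 2).
    apply: H => e e1; have [_ Ge Ge'] := unit_sign_gauss e1 e1.
    + have n1 : nsq (- (e +i* 0)) = 1 by rewrite /nsq /=; lra.
      by move: (box _ (gaussN Ge) n1); case: (sqr_eq1P e1) => ->; rewrite /nsq /= => -[] ?;
        [left|right|left|right]; lra.
    + have n1 : nsq (0 +i* e) = 1 by rewrite /nsq /=; lra.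
      by move: (box _ Ge' n1); case: (sqr_eq1P e1) => ->; rewrite /nsq /= => -[] ?;
        [left|right|left|right]; lra.
  rewrite /nsq /=; lra.
Qed.

End MinimalPair.

(** * Existence of good approximations *)

Section DirichletConstant.
Variable R : realType.
Local Notation G := (@gaussian_integers R).
Implicit Types (p q z a b : R[i]).

(** Dividing first coordinates by [qv] and second ones by [qu * z - pu] turns [box] into the
    emptiness assumed by [empty_box_det_ge]. *)
Lemma minimal_pair_le (k : R) (qu pu qv pv z : R[i]) :
  0 < k -> k ^+ 2 = 3 -> G qu -> G pu -> G qv -> G pv ->
  normc qu < normc qv -> normc (qv * z - pv) < normc (qu * z - pu) ->
  (forall q p, G q -> G p -> normc q < normc qv ->
     normc (q * z - p) < normc (qu * z - pu) -> q = 0 /\ p = 0) ->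
  nsq (qv * (qu * z - pu)) * (6 - 3 * k) <= 1.
Proof.
move=> k0 k3 Gqu Gpu Gqv Gpv quv yvu box.
have yu0 : qu * z - pu != 0 by rewrite -normc_gt0 (le_lt_trans (normc_ge0 _) yvu).
have qv0 : qv != 0 by rewrite -normc_gt0 (le_lt_trans (normc_ge0 _) quv).
have u0 : ~ (qu = 0 /\ pu = 0).
  by case=> q0 p0; move: yu0; rewrite q0 p0 mul0r subr0 eqxx.
have [d [r [s [q [p [[Gd Gr Gs Gq Gp] d0 quE puE rs]]]]]] := gauss_bezout Gqu Gpu u0.
have yE : qu * z - pu = d * (q * z - p) by rewrite quE puE; ring.
have dge1 := normc_gauss_ge1 Gd d0.
have qv' : normc q < normc qv.
  by apply: le_lt_trans quv; rewrite quE normcM ler_peMl // normc_ge0.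
(* A vector divided by a non-unit would have a smaller second coordinate, against [box]; so u is
   primitive up to a unit. *)
have d1 : normc d = 1.
  apply/eqP; rewrite eq_le dge1 andbT leNgt; apply/negP => d1.
  have [|q0 p0] := box q p Gq Gp qv'.
    rewrite yE normcM ltr_pMl // normc_gt0.
    by apply: contra yu0 => /eqP y0; rewrite yE y0 mulr0.
  by apply: u0; rewrite quE puE q0 p0 mulr0.
have ny : normc (qu * z - pu) = normc (q * z - p) by rewrite yE normcM d1 mul1r.
rewrite nsqM -[nsq (_ - _)]normc_sqr ny normc_sqr -nsqM.
rewrite ny in yvu box.
have y0 : q * z - p != 0 by rewrite -normc_gt0 (le_lt_trans (normc_ge0 _) yvu).
move: yu0 {quE puE yE u0 ny d0 dge1 d1 quv Gqu Gpu} => _.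
pose D := q * pv - p * qv.
have DE : D = qv * (q * z - p) - q * (qv * z - pv) by rewrite /D; ring.
have D0 : D != 0.
  rewrite -normc_gt0 DE (lt_le_trans _ (normc_leB _ _)) // subr_gt0 !normcM.
  by rewrite ltr_pM ?normc_ge0.
have GD : G D by apply: gaussB; exact: gaussM.
pose k1 := r * qv + s * pv.
have [m [Gm m1 m2]] := round_gauss (k1 / D).
pose kap := k1 - m * D.
have Gk : G kap by do !apply: gaussB || apply: gaussD || apply: gaussM.
(* (qw, pw) completes (q, p) to a basis; the multiple m of (q, p) is chosen so that kap is reduced
   modulo D. *)
pose qw := - s + m * q; pose pw := r + m * p.
have qvE : qv = D * qw + kap * q.
  rewrite /qw /kap /k1 /D -[LHS]mul1r -rs; ring.
have pvE : pv = D * pw + kap * p.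
  rewrite /pw /kap /k1 /D -[LHS]mul1r -rs; ring.
have wdet : q * pw - p * qw = 1 by rewrite /pw /qw -rs; ring.
pose a := q / qv; pose b := (qv * z - pv) / (q * z - p).
have nsq0 (x : R[i]) : x != 0 -> 0 < nsq x.
  by move=> x0; rewrite -normc_sqr exprn_gt0 // normc_gt0.
have det : nsq D * (6 - 3 * k) <= nsq (1 - a * b).
  apply: (@empty_box_det_ge R k a b D kap) => //.
  - by rewrite -normc_lt1 normc_div ltr_pdivrMr ?mul1r // normc_gt0.
  - by rewrite -normc_lt1 normc_div ltr_pdivrMr ?mul1r // normc_gt0.
  - by rewrite /kap mulrBl mulfK.
  - by rewrite /kap mulrBl mulfK.
  move=> x t Gx Gt xt0; apply: contrapT => /not_orP[/negP h1 /negP h2].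
  apply: xt0; rewrite -!ltNge -!normc_lt1 in h1 h2.
  have Gqw : G qw by apply: gaussD; [exact: gaussN|exact: gaussM].
  have Gpw : G pw by apply: gaussD; [|exact: gaussM].
  have e : qv * (x * a + t * ((1 - kap * a) / D)) = x * q + t * qw.
    have -> : qw = (qv - kap * q) / D by rewrite {1}qvE addrK mulrC mulKf.
    by rewrite /a; field; rewrite D0.
  have yw : qw * z - pw = (qv * z - pv - kap * (q * z - p)) / D.
    rewrite {1}qvE pvE; apply: (mulIf D0); rewrite divfK //; ring.
  have e' : (q * z - p) * (x + t * ((b - kap) / D)) = (x * q + t * qw) * z - (x * p + t * pw).
    rewrite [RHS](_ : _ = x * (q * z - p) + t * (qw * z - pw)); last by ring.
    by rewrite yw /b; field; rewrite D0 y0.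
  have [||xq xp] := box _ _ (gaussD (gaussM Gx Gq) (gaussM Gt Gqw)) (gaussD (gaussM Gx Gp)
    (gaussM Gt Gpw)).
  - by rewrite -e normcM gtr_pMr ?normc_gt0.
  - by rewrite -e' normcM gtr_pMr ?normc_gt0.
  have t0 : t = 0.
    rewrite -[t]mulr1 -wdet (_ : _ * _ = q * (x * p + t * pw) - p * (x * q + t * qw)); last by ring.
    by rewrite xq xp !mulr0 subr0.
  have x0 : x = 0.
    rewrite -[x]mulr1 -wdet (_ : _ * _ = pw * (x * q + t * qw) - qw * (x * p + t * pw));
      last by ring.
    by rewrite xq xp !mulr0 subr0.
  by [].
have E : nsq (qv * (q * z - p)) * nsq (1 - a * b) = nsq D.
  rewrite -nsqM; congr nsq; rewrite DE /a /b; field; rewrite y0 qv0 //.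
rewrite -(ler_pM2l (nsq0 _ D0)) mulr1 -[leRHS]E mulrCA; apply: ler_wpM2l => //.
exact: nsq_ge0.
Qed.

(** Euclid's algorithm on two values q z - p, q' z - p': each division at least halves the squared
    modulus, and the nonzero determinant keeps (q, p) from vanishing. *)
Lemma dirichlet_weak z (e : R) : 0 < e ->
  exists q p, [/\ G q, G p, ~ (q = 0 /\ p = 0) & normc (q * z - p) < e].
Proof.
move=> e0.
have H n : exists q p q' p', [/\ [/\ G q, G p, G q' & G p'], q * p' - q' * p != 0 &
    nsq (q * z - p) <= (2^-1) ^+ n].
  elim: n => [|n [q [p [q' [p' [[Gq Gp Gq' Gp'] qp h]]]]]].
    exists 0, 1, 1, 0; split; first by split;
      [exact: gauss0|exact: gauss1|exact: gauss1|exact: gauss0].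
      by rewrite mul0r mulr1 sub0r oppr_eq0 oner_eq0.
    by rewrite mul0r sub0r -normc_sqr normcN normc1 expr1n expr0.
  have [y0|y0] := eqVneq (q * z - p) 0.
    by exists q, p, q', p'; rewrite y0; split => //;
      rewrite /nsq /= expr0n addr0 exprn_ge0 // invr_ge0.
  have [k [Gk h1 h2]] := round_gauss ((q' * z - p') / (q * z - p)).
  exists (q' - k * q), (p' - k * p), q, p; split.
  - by split=> //; apply: gaussB => //; exact: gaussM.
  - by rewrite (_ : _ - _ = - (q * p' - q' * p)) ?oppr_eq0 //; ring.
  rewrite (_ : _ - _ = ((q' * z - p') / (q * z - p) - k) * (q * z - p)); last by field.
  rewrite nsqM exprS; apply: ler_pM => //; rewrite ?nsq_ge0 //.
  by have := nsq_le_half h1 h2; lra.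
have [n hn] : exists n, (2^-1 : R) ^+ n < e ^+ 2.
  have /cvgrPdist_lt /(_ _ (exprn_gt0 2 e0)) : (fun n => (2^-1 : R) ^+ n) @ \oo --> (0 : R).
    by apply: cvg_expr; rewrite ger0_norm; lra.
  by case=> n _ /(_ n (leqnn n)) /=; rewrite sub0r normrN ger0_norm ?exprn_ge0 //; exists n.
have [q [p [q' [p' [[Gq Gp Gq' Gp'] qp h]]]]] := H n.
exists q, p; split=> //; first by case=> q0 p0; move: qp; rewrite q0 p0 mul0r mulr0 subr0 eqxx.
rewrite -(ltr_sqr) ?nnegrE ?normc_ge0 ?(ltW e0) // normc_sqr; exact: le_lt_trans h hn.
Qed.

Lemma round_gauss_nearest z : exists p, [/\ G p, nsq (z - p) <= 1/2 &
  forall p', G p' -> nsq (z - p) <= nsq (z - p')].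
Proof.
case: z => x y; have [m hm] := round_int x; have [n hn] := round_int y.
have near (t : R) (c d : int) : `|t - c%:~R| <= 1/2 -> (t - c%:~R) ^+ 2 <= (t - d%:~R) ^+ 2.
  move=> h; have [->//|cd] := eqVneq c d.
  rewrite -[leLHS](real_normK (num_real _)) -[leRHS](real_normK (num_real _)).
  rewrite ler_sqr ?nnegrE //.
  have : 1 <= `|c%:~R - d%:~R| :> R.
    have : 1 <= `|c - d| by clear -cd; lia.
    by rewrite -(ler_int R) intr_norm rmorphB.
  have : `|c%:~R - d%:~R : R| <= `|t - c%:~R| + `|t - d%:~R|.
    by rewrite [`|t - c%:~R|]distrC; apply: (@ler_distD R R t).
  lra.
exists (m%:~R +i* n%:~R); split.
- by exists m, n.
- by apply: nsq_le_half.
by move=> _ [m' [n' ->]]; rewrite /nsq /=; apply: lerD; exact: near.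
Qed.

Lemma best_gauss_approx z (B : R) : 1 < B -> exists q p, [/\ G q, G p, q != 0, normc q < B &
  forall q' p', G q' -> G p' -> q' != 0 -> normc q' < B ->
    nsq (q * z - p) <= nsq (q' * z - p')].
Proof.
move=> B1.
have /choice[rd rdP] := fun q => round_gauss_nearest (q * z).
have [M BM] : exists M : nat, B <= M%:R.
  by exists (Num.truncn B).+1; apply: ltW; exact: truncnS_gt.
(* A finite search: ordinals shifted by M enumerate the coordinates from -M to M, and the best p for
   a given q is the rounding of q z. *)
pose f (ij : 'I_(M.*2.+1) * 'I_(M.*2.+1)) : R[i] :=
  ((ij.1 : nat)%:Z - M%:Z)%:~R +i* ((ij.2 : nat)%:Z - M%:Z)%:~R.
pose P ij := (f ij != 0) && (normc (f ij) < B).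
pose F ij := nsq (f ij * z - rd (f ij)).
have fP q : G q -> normc q < B -> exists ij, f ij = q.
  move=> [a [b ->]] qB.
  have aM (c : int) : (c%:~R : R) ^+ 2 <= nsq (a%:~R +i* b%:~R : R[i]) ->
      exists i : 'I_(M.*2.+1), (i : nat)%:Z - M%:Z = c.
    move=> h; have : `|c%:~R : R| < M%:R.
      rewrite -(ltr_sqr) ?nnegrE // real_normK ?num_real // (le_lt_trans h) //.
      by rewrite -normc_sqr ltr_sqr ?nnegrE ?normc_ge0 // (lt_le_trans qB).
    rewrite -intr_norm -[M%:R]/(M%:Z%:~R) ltr_int => cM.
    have iM : (absz (c + M%:Z)%R < M.*2.+1)%N by lia.
    by exists (Ordinal iM) => /=; lia.
  have [|i iE] := aM a; first by rewrite /nsq /= lerDl sqr_ge0.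
  have [|j jE] := aM b; first by rewrite /nsq /= lerDr sqr_ge0.
  by exists (i, j); rewrite /f /= iE jE.
have [ij0 ij0E] := fP 1 (gauss1 R) ltac:(by rewrite normc1).
have P0 : P ij0 by rewrite /P ij0E oner_eq0 normc1.
case: (@arg_minP _ _ _ ij0 P F P0) => ij /andP[fij0 fijB] H.
have [Gr _ rmin] := rdP (f ij).
exists (f ij), (rd (f ij)); split=> //; first by eexists; eexists.
move=> q p Gq Gp q0 qB; have [ij' ij'E] := fP q Gq qB.
apply: le_trans (H ij' _) _; first by rewrite /P ij'E q0 qB.
by rewrite /F ij'E; have [_ _] := rdP q; exact.
Qed.

Lemma dirichlet_constant_optimal (k c : R) z : 0 < k -> k ^+ 2 = 3 ->
  0 < c -> 1 <= c -> c ^+ 2 * (6 - 3 * k) = 1 -> @dirichlet_constant R z c.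
Proof.
move=> k0 k3 c0 c1 ck Q Q1.
have Q0 : 0 < Q by lra.
suff [q [p [Gq Gp q0 qQ h]]] : exists q p,
    [/\ G q, G p, q != 0, normc q < Q & normc (q * z - p) <= c / Q].
  exists p, q; split=> //; rewrite !normr_normc; last by rewrite lecR.
  by rewrite -[0]/(0%:C) !ltcR normc_gt0 q0.
(* If c/Q >= 1, then q = 1 and the rounding of z suffice. *)
have [Qc|Qc] := leP Q c.
  have [p [Gp h1 h2]] := round_gauss z.
  exists 1, p; split; [exact: gauss1|exact: Gp|exact: oner_neq0|by rewrite normc1|].
  rewrite mul1r (@le_trans _ _ 1) ?ler_pdivlMr ?mul1r // normc_le1.
  by have := nsq_le_half h1 h2; lra.
apply: contrapT => nex.
have far q p : G q -> G p -> q != 0 -> normc q < Q -> c / Q < normc (q * z - p).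
  move=> ? ? ? ?; rewrite ltNge; apply/negP => ?; apply: nex; by exists q, p.
have cQ : c / Q < 1 by rewrite ltr_pdivrMr // mul1r.
have cQ0 : 0 < c / Q by exact: divr_gt0.
have [qv [pv [Gqv Gpv qv0 yv vmin]]] : exists q p, [/\ G q, G p, q != 0,
    normc (q * z - p) <= c / Q & forall q' p', G q' -> G p' -> q' != 0 ->
      normc (q' * z - p') <= c / Q -> normc q <= normc q'].
  pose P (n : nat) := `[< exists q p, [/\ G q, G p, q != 0,
    normc (q * z - p) <= c / Q & nsq q = n%:R] >].
  have exP : exists n, P n.
    have [q [p [Gq Gp qp0 h]]] := dirichlet_weak z cQ0.
    have [n nE] := nsq_gauss Gq; exists n; apply/asboolP; exists q, p; split=> //; last exact: ltW.
    apply/eqP => q0; apply: qp0; split=> //; apply/eqP/negPn/negP => p0.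
    move: h; rewrite q0 mul0r sub0r normcN.
    by have := normc_gauss_ge1 Gp p0; lra.
  case: (ex_minnP exP) => n /asboolP[q [p [Gq Gp q0 h nE]]] nmin.
  exists q, p; split=> // q' p' Gq' Gp' q0' h'.
  have [n' nE'] := nsq_gauss Gq'.
  rewrite ler_normc nE nE' ler_nat; apply: nmin; apply/asboolP.
  by exists q', p'.
have Qv : Q <= normc qv.
  by rewrite leNgt; apply/negP => h; have := far _ _ Gqv Gpv qv0 h; rewrite ltNge yv.
have [qu [pu [Gqu Gpu qu0 quv umin]]] := best_gauss_approx z (lt_le_trans Q1 Qv).
have yu : c / Q < normc (qu * z - pu).
  by rewrite ltNge; apply/negP => h; have := vmin _ _ Gqu Gpu qu0 h; rewrite leNgt quv.
have := @minimal_pair_le k qu pu qv pv z k0 k3 Gqu Gpu Gqv Gpv quv (le_lt_trans yv yu).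
have box q p : G q -> G p -> normc q < normc qv ->
    normc (q * z - p) < normc (qu * z - pu) -> q = 0 /\ p = 0.
  move=> Gq Gp hq; rewrite ltr_normc => hy.
  have [q0|q0] := eqVneq q 0; last first.
    by have := umin _ _ Gq Gp q0 hq; rewrite leNgt hy.
  split=> //; apply/eqP/negPn/negP => p0.
  (* With q = 0 the second coordinate has modulus |p| >= 1, but the competitor q = 1 shows |y_u|^2
     <= 1/2. *)
  have [r [Gr r1 r2]] := round_gauss (1 * z).
  have : nsq (qu * z - pu) <= nsq (1 * z - r).
    by apply: (umin 1 r (gauss1 R) Gr (oner_neq0 _)); rewrite normc1; lra.
  have := nsq_le_half r1 r2; have := nsq_gauss_ge1 Gp p0.
  by move: hy; rewrite q0 mul0r sub0r -[nsq (- p)]normc_sqr normcN normc_sqr; lra.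
move=> /(_ box); rewrite leNgt => /negP; apply.
have k6 : 0 < 6 - 3 * k.
  rewrite ltNge; apply/negP => ?; have : c ^+ 2 * (6 - 3 * k) <= 0 by rewrite mulr_ge0_le0 ?sqr_ge0.
  lra.
rewrite -[ltLHS]ck ltr_pM2r // -normc_sqr ltr_sqr ?nnegrE ?normc_ge0 ?(ltW c0) // normcM.
(* c = Q (c/Q) < |q_v| |y_u| contradicts the bound on the minimal pair. *)
rewrite -[c](divfK (lt0r_neq0 Q0)) mulrC.
apply: (@le_lt_trans _ _ (normc qv * (c / Q))); first by apply: ler_wpM2r => //; exact: ltW.
by rewrite ltr_pM2l // normc_gt0.
Qed.

End DirichletConstant.

(** * Porous subsets of the plane *)

Section Plane.
Variable R : realType.
Implicit Types (c h : R * R) (r : R) (A E : set (R * R)).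

Local Notation mu := ((@lebesgue_measure R) \x (@lebesgue_measure R))%E.

Lemma ball_plane c r : ball c r = ball c.1 r `*` ball c.2 r.
Proof. by []. Qed.

Lemma measurable_ball_plane c r : measurable (ball c r : set (R * R)).
Proof. by rewrite ball_plane; apply: measurableX; rewrite ball_itv; exact: measurable_itv. Qed.

(** Balls of the product R * R are squares of side 2r. *)
Lemma measure_ball_plane c r : 0 <= r -> mu (ball c r) = ((2 * r) ^+ 2)%:E.
Proof.
move=> r0; rewrite ball_plane.
have m x : measurable (ball x r : set R) by rewrite ball_itv; exact: measurable_itv.
transitivity (lebesgue_measure (ball c.1 r : set R) * lebesgue_measure (ball c.2 r : set R))%E.
  by apply: product_measure1E; exact: m.
rewrite !lebesgue_measure_ball //.
by rewrite -EFinM mulr_natl expr2.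
Qed.

Lemma open_measurable_plane A : open A -> measurable A.
Proof.
move=> oA.
(* An open set is the countable union of the squares with rational centre and radius 1/(n + 1) that
   it contains. *)
pose F (i : rat * rat * nat) := let B := ball (ratr i.1.1 : R, ratr i.1.2 : R) i.2.+1%:R^-1 in
  if `[< B `<=` A >] then B else set0.
have -> : A = \bigcup_i F i.
  apply/seteqP; split => x; last first.
    by move=> [i _]; rewrite /F; case: asboolP => // BA /BA.
  move=> Ax; have /nbhs_ballP[e /= e0 eA] : nbhs x A by exact: open_nbhs_nbhs.
  have e2 : 0 < e / 2 by rewrite divr_gt0.
  have [n _ /(_ n (leqnn n)) /= ne] := near_infty_natSinv_lt (PosNum e2).
  have n0 : 0 < n.+1%:R^-1 :> R by rewrite invr_gt0.
  have lt_itv (t a : R) : 0 < a -> t - a < t + a by lra.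
  have [q1 /=] := @rat_in_itvoo R (x.1 - n.+1%:R^-1) (x.1 + n.+1%:R^-1) (lt_itv _ _ n0).
  have [q2 /=] := @rat_in_itvoo R (x.2 - n.+1%:R^-1) (x.2 + n.+1%:R^-1) (lt_itv _ _ n0).
  move=> h2 h1.
  have xq : ball (ratr q1 : R, ratr q2 : R) n.+1%:R^-1 x.
    by split; apply: ball_sym; rewrite ball_itv.
  exists (q1, q2, n) => //; rewrite /F asboolT // => y qy; apply: eA.
  apply: (@le_ball _ _ _ (n.+1%:R^-1 + n.+1%:R^-1)); first by rewrite [leRHS]splitr lerD ?ltW.
  by apply: ball_triangle qy; apply: ball_sym.
apply: countable_bigcupT_measurable => [|i]; first exact: countableP.
by rewrite /F; case: ifP => _; [exact: measurable_ball_plane|exact: measurable0].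
Qed.

(* [compact_cover] asks for a pointed space, and R * R has no such canonical instance. *)
Lemma cover_compact_plane E : compact E -> cover_compact E.
Proof.
pose T : ptopologicalType :=
  HB.pack (R * R)%type (Topological.on (R * R)%type) (Pointed.on (R * R)%type).
move=> cE; have h : @compact T E by [].
by rewrite compact_cover in h; exact: h.
Qed.

(** Induction on the list sorted by increasing radius: the head, being smallest, is kept if it
    misses every selected ball, and otherwise lies in the triple of one that it meets. *)
Lemma vitali_selection (I : eqType) (c : I -> R * R) (r : I -> R) (s : seq I) :
  (forall i, i \in s -> 0 < r i) ->
  exists D : seq I, [/\ {subset D <= s}, trivIset [set` D] (fun i => ball (c i) (r i)) &
    forall i, i \in s -> exists2 j, j \in D & ball (c i) (r i) `<=` ball (c j) (3 * r j)].
Proof.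
pose le_r x y := r x <= r y.
wlog srt : s / sorted le_r s.
  move=> H r0; have [||D [Ds tD cD]] := H (sort le_r s).
  - by apply: sort_sorted => x y; exact: le_total.
  - by move=> i; rewrite mem_sort; exact: r0.
  exists D; split=> //; first by move=> i /Ds; rewrite mem_sort.
  by move=> i; rewrite -(mem_sort le_r); exact: cD.
elim: s srt => [_ _|i s IH srt r0].
  by exists [::]; split => // i j; rewrite /= in_nil.
have [||D [Ds tD cD]] := IH.
- exact: path_sorted srt.
- by move=> j js; apply: r0; rewrite in_cons js orbT.
have le_i j : j \in D -> r i <= r j.
  have le_trans' : transitive le_r by move=> x y z; exact: le_trans.
  by move=> /Ds; have /allP := order_path_min le_trans' srt; exact.
have ri : 0 < r i by apply: r0; rewrite mem_head.
have sub x y (z : R * R) : 0 < r y -> r x <= r y -> ball (c x) (r x) z -> ball (c y) (r y) z ->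
    ball (c x) (r x) `<=` ball (c y) (3 * r y).
  move=> y0 xy xz yz w xw; rewrite (_ : 3 * r y = r y + (r y + r y)); last by ring.
  apply: ball_triangle yz _; apply: ball_triangle (_ : ball z (r y) (c x)) _.
    by apply: ball_sym; exact: le_ball xy _ xz.
  exact: le_ball xy _ xw.
have [[j jD [z [iz jz]]]|no] := pselect (exists2 j, j \in D & ball (c i) (r i) `&` ball (c j)
  (r j) !=set0).
  exists D; split=> //; first by move=> k /Ds ks; rewrite in_cons ks orbT.
  move=> k; rewrite in_cons => /predU1P[->|]; last exact: cD.
  by exists j => //; apply: sub iz jz; [exact: lt_le_trans ri (le_i _ jD)|exact: le_i].
exists (i :: D); split.
- by move=> k; rewrite !in_cons => /predU1P[->|/Ds ->]; rewrite ?eqxx ?orbT.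
- move=> k l; rewrite /= !in_cons => /predU1P[->|kD] /predU1P[->|lD] //.
  + by move=> h; case: no; exists l.
  + by rewrite setIC => h; case: no; exists k.
  + exact: tD.
- move=> k; rewrite in_cons => /predU1P[->|/cD [j jD kj]].
    exists i; first by rewrite mem_head.
    by apply: le_ball; rewrite -[leLHS]mul1r ler_wpM2r //; [exact: ltW|lra].
  by exists j => //; rewrite in_cons jD orbT.
Qed.

(** A Vitali selection gives disjoint balls inside the 1/(n + 1)-neighbourhood of E whose triples
    cover E; each contains a hole that misses E. So mu E is at most a constant times the measure of
    the neighbourhood minus E, which tends to 0. *)
Lemma porous_null (d N : R) E : 0 < d -> d <= 1 -> compact E -> E `<=` ball (0, 0) N ->
  (forall z, E z -> forall e, 0 < e -> exists h r,
     [/\ 0 < r, r < e, ball z r h & ball h (d * r) `&` E = set0]) ->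
  mu E = 0%E.
Proof.
move=> d0 d1 cE EN por.
have clE : closed E by apply: compact_closed => //; exact: norm_hausdorff.
have mE : measurable E by rewrite -(setCK E); apply: measurableC; apply: open_measurable_plane;
  exact: closed_openC.
pose O n := \bigcup_(z in E) ball z (n.+1%:R^-1 : R).
have oO n : open (O n) by apply: bigcup_open => z _; exact: ball_open.
have mO n : measurable (O n) by exact: open_measurable_plane.
have EO n : E `<=` O n by move=> z Ez; exists z => //; apply: ballxx; rewrite invr_gt0.
pose F n := O n `\` E.
have mF n : measurable (F n) by exact: measurableD.
(* Ratio of the areas of the tripled ball, of radius 6r, and of the hole, of radius d r. *)
pose K := 36 / d ^+ 2.
have K0 : 0 <= K by rewrite divr_ge0 // sqr_ge0.
have bound n : (mu E <= K%:E * mu (F n))%E.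
  have /choice[g gP] : forall z, exists hr : (R * R) * R, E z ->
      [/\ 0 < hr.2, ball z hr.2 hr.1, ball hr.1 (d * hr.2) `&` E = set0 & ball z (2 * hr.2)
        `<=` O n].
    move=> z; have [Ez|nEz] := pselect (E z); last by exists (0, 0) => /nEz.
    have [|h [r [r0 rn zh hE]]] := por z Ez (n.+1%:R^-1 / 2); first by rewrite divr_gt0 ?invr_gt0.
    exists (h, r) => _; split=> //= w zw; exists z => //.
    by apply: le_ball zw; rewrite /= mulrC -ler_pdivlMr // ltW.
  have cE' : cover_compact E := cover_compact_plane cE.
  have := cE' (R * R)%type E (fun z => ball z (2 * (g z).2)); case.
  - by move=> z _; exact: ball_open.
  - by move=> z Ez; exists z => //; apply: ballxx; have [] := gP z Ez; lra.
  move=> s sE cov.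
  have sE' z : z \in finmap.enum_fset s -> E z by move=> zs; apply/set_mem; exact: sE.
  have [|D [Ds tD cD]] := @vitali_selection (R * R)%type id (fun z => 2 * (g z).2)
    (finmap.enum_fset s).
    by move=> z /sE' Ez; have [] := gP z Ez; lra.
  have DE z : [set` D] z -> E z by move=> /= /Ds; exact: sE'.
  have fD : finite_set [set` D] by exact: finite_seq.
  have EB : E `<=` \bigcup_(z in [set` D]) ball z (3 * (2 * (g z).2)).
    move=> z /cov [w ws wz]; have [j jD] := cD w ws; move=> /(_ z wz) jz.
    by exists j.
  have H1 := @content_sub_fsum _ _ _ mu _ _ _ _ fD (fun z _ => measurable_ball_plane z _) mE EB.
  apply: (le_trans H1).
  have hole z : E z -> ball (g z).1 (d * (g z).2) `<=` ball z (2 * (g z).2).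
    move=> Ez w; have [r0 zh _ _] := gP z Ez => hw.
    rewrite (_ : 2 * _ = (g z).2 + (g z).2); last by ring.
    apply: ball_triangle zh _; apply: le_ball hw.
    by rewrite -[leRHS]mul1r ler_wpM2r // ltW.
  have tH : trivIset [set` D] (fun z => ball (g z).1 (d * (g z).2)).
    move=> z w zD wD [x [xz xw]]; apply: tD => //; exists x; split; by apply: hole => //; exact: DE.
  have H2 := @measure_fin_bigcup _ _ _ mu _ _ _ fD tH (fun z _ => measurable_ball_plane _ _).
  have : (mu (\bigcup_(z in [set` D]) ball (g z).1 (d * (g z).2)) <= mu (F n))%E.
    apply: le_measure; [apply/mem_set|apply/mem_set; exact: mF|].
      by apply: fin_bigcup_measurable => // z _; exact: measurable_ball_plane.
    move=> x [z zD xz]; have [_ _ hE hO] := gP z (DE z zD); split;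
      first by apply/hO/hole => //; exact: DE.
    by move=> Ex; have : set0 x by rewrite -hE.
  rewrite H2 => /(lee_wpmul2l (_ : (0 <= K%:E)%E)) => /(_ ltac:(by rewrite lee_fin));
    apply: le_trans.
  rewrite ge0_mule_fsumr; last by move=> z; exact: measure_ge0.
  apply: lee_fsum => // z zD; have [r0 _ _ _] := gP z (DE z zD).
  have a1 := @measure_ball_plane z (3 * (2 * (g z).2)) ltac:(by rewrite !mulr_ge0 ?ltW).
  have a2 := @measure_ball_plane (g z).1 (d * (g z).2) ltac:(by rewrite mulr_ge0 ?ltW).
  rewrite -[leLHS]/(mu (ball z _)) -[X in (_ * X)%E]/(mu (ball (g z).1 _)) a1 a2.
  rewrite -EFinM lee_fin le_eqVlt; apply/orP; left; apply/eqP.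
  by rewrite /K; field; rewrite lt0r_neq0.
have F0 : (mu \o F) n @[n --> \oo] --> mu (\bigcap_n F n).
  apply: nonincreasing_cvg_mu => //.
  - apply: (@le_lt_trans _ _ (mu (ball (0, 0) (`|N| + 1)))); last first.
      by rewrite measure_ball_plane ?ltry // addr_ge0.
    apply: le_measure; [apply/mem_set; exact: mF|apply/mem_set; exact: measurable_ball_plane|].
    move=> x [[z Ez zx] _]; apply: ball_triangle (_ : ball (0, 0) `|N| z) _.
      by apply: le_ball (ler_norm N) _ _; exact: EN.
    by apply: le_ball zx; rewrite invr1.
  - by apply: bigcapT_measurable => n; exact: mF.
  - move=> m n mn; apply/subsetPset => x [[z Ez zx] nEx]; split => //; exists z => //.
    by apply: le_ball zx; rewrite lef_pV2 ?posrE // ler_nat ltnS.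
have F00 : \bigcap_n F n = set0.
  apply/seteqP; split => // x Fx; have [_ nEx] := Fx 0%N I.
  have /nbhs_ballP[e /= e0 eA] : nbhs x (~` E).
    by apply: open_nbhs_nbhs; split => //; exact: closed_openC.
  have [n _ /(_ n (leqnn n)) /= ne] := near_infty_natSinv_lt (PosNum e0).
  have [[z Ez zx] _] := Fx n I.
  by apply: (eA z) => //; apply: ball_sym; apply: le_ball zx; exact: ltW.
rewrite F00 measure0 in F0.
apply/eqP; rewrite -measure_le0.
have : (fun n => K%:E * (mu \o F) n)%E @ \oo --> (K%:E * 0)%E by exact: cvgeZl F0.
rewrite mule0; apply: cvge_ge; exact: nearW.
Qed.


Lemma range_small_cover (f : nat -> R * R) (e : R) : 0 < e ->
  exists W, [/\ open W, range f `<=` W & (mu W <= e%:E)%E].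
Proof.
(* The n-th square then has area e / 2^(n+1), and these areas sum to e. *)
move=> e0; pose r n := Num.sqrt (e / (2 ^ n.+1)%:R) / 2.
have q0 n : 0 < e / (2 ^ n.+1)%:R by rewrite divr_gt0 // ltr0n expn_gt0.
have r0 n : 0 < r n by rewrite divr_gt0 // sqrtr_gt0.
exists (\bigcup_n ball (f n) (r n)); split.
- by apply: bigcup_open => n _; exact: ball_open.
- by move=> _ [n _ <-]; exists n => //; exact: ballxx.
have mU : measurable (\bigcup_n ball (f n) (r n)).
  by apply: bigcupT_measurable => n; exact: measurable_ball_plane.
apply: le_trans (measure_sigma_subadditive mu (fun n => measurable_ball_plane _ _) mU
  (@subset_refl _ _)) _.
apply: le_trans (epsilon_trick0 xpredT (ltW e0)).
rewrite (@eq_eseriesr _ _ (fun n => (e / (2 ^ n.+1)%:R)%:E)) // => n _.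
rewrite [LHS](measure_ball_plane _ (ltW (r0 n))); congr EFin.
by rewrite /r mulrC divfK // sqr_sqrtr // ltW.
Qed.

(** The complement of U is cut by the compact squares [B N]; removing a small open cover of the
    range of f leaves a compact set that is porous at each of its points. *)
Lemma porous_negligible (d : R) U (f : nat -> R * R) : 0 < d -> d <= 1 -> open U ->
  (forall z, ~ range f z -> forall e, 0 < e -> exists h r,
     [/\ 0 < r, r < e, ball z r h & ball h (d * r) `<=` U]) ->
  mu.-negligible (~` U).
Proof.
move=> d0 d1 oU por.
pose B (N : nat) : set (R * R) := `[- N%:R, N%:R]%classic `*` `[- N%:R, N%:R]%classic.
have cB N : compact (B N) by apply: compact_setX; exact: segment_compact.
have plane_closed A : compact A -> measurable A.
  move=> cA; rewrite -(setCK A); apply: measurableC; apply: open_measurable_plane.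
  by apply: closed_openC; apply: compact_closed => //; exact: norm_hausdorff.
have cBU N A : open A -> compact (B N `\` A).
  by move=> oA; rewrite setDE; apply: compact_closedI => //; exact: open_closedC.
have -> : ~` U = \bigcup_N (B N `\` U).
  apply/seteqP; split => [x nUx|x [N _ []]//].
  exists (Num.truncn (`|x.1| + `|x.2|)).+1 => //; split => //.
  have h := truncnS_gt (`|x.1| + `|x.2|).
  have n1 := normr_ge0 x.1; have n2 := normr_ge0 x.2.
  by split; rewrite /= in_itv /= -ler_norml; lra.
apply: negligible_bigcup => N.
have mBU : measurable (B N `\` U) by exact: plane_closed (cBU _ _ oU).
apply/negligibleP => //; apply/eqP; rewrite -measure_le0.
apply/lee_addgt0Pr => e e0; rewrite add0e.
have [W [oW fW We]] := range_small_cover f e0.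
have mW : measurable W by exact: open_measurable_plane.
have E0 : mu (B N `\` (U `|` W)) = 0%E.
  apply: (@porous_null d (N%:R + 1)) => //.
  - by apply: cBU; exact: openU.
  - move=> [x y] [[/= h1 h2] _]; rewrite !in_itv /= -!ler_norml in h1 h2.
    split; rewrite /ball /= sub0r normrN.
      by apply: (le_lt_trans h1); rewrite ltrDl.
    by apply: (le_lt_trans h2); rewrite ltrDl.
  move=> z [_ zUW] t t0; have [|h [r [r0 rt zh hU]]] := por z _ t t0.
    by move=> /fW Wz; apply: zUW; right.
  exists h, r; split => //; apply/seteqP; split => // w [/hU Uw [_]]; apply; by left.
have mE : measurable (B N `\` (U `|` W)) by apply: plane_closed; apply: cBU; exact: openU.
have : (mu (B N `\` U) <= mu (B N `\` (U `|` W)) + mu W)%E.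
  apply: (@le_trans _ _ (mu ((B N `\` (U `|` W)) `|` W))); last exact: (measureU2 mu mE mW).
  apply: le_measure; [exact/mem_set|apply/mem_set; exact: measurableU|].
  move=> x [Bx nUx]; have [Wx|nWx] := pselect (W x); first by right.
  by left; split => // -[].
by move/le_trans; apply; rewrite [X in (X + _)%E](_ : _ = 0%E) ?add0e.
Qed.

End Plane.

(** * The critical lattice *)

Section Critical.
Variable R : realType.
Local Notation G := (@gaussian_integers R).
Implicit Types (p q z a b x y : R[i]).

Lemma normc_sqrt z : normc z = Num.sqrt (nsq z).
Proof. by case: z. Qed.

(** In the sum of the two squared moduli the cross terms cancel, which leaves (|s|^2 + |u|^2)(1 + 2
    t^2) < 4 and so |s|^2 + |u|^2 < 4. This integer is even because u = s modulo 1 + i. If it is 2,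
    one squared modulus is at least 2; for units s, u it is 1 + 2 t^2 + 2 t = 2. *)
Lemma critical_form (t : R) s u : 0 < t -> 2 * t ^+ 2 + 2 * t = 1 ->
  G s -> G u -> (exists a, G a /\ u = (1 + 'i) * a + s) ->
  nsq (s * (t +i* t) + u) < 2 -> nsq (s + u * (- t +i* t)) < 2 -> s = 0 /\ u = 0.
Proof.
move=> t0 tE [s1 [s2 sE]] [u1 [u2 uE]] [a [[a1 [a2 aE]] ua]].
have {ua} [e1 e2] : u1 = a1 - a2 + s1 /\ u2 = a1 + a2 + s2.
  move: ua; rewrite uE aE sE => /eqP; rewrite eq_complex /=.
  rewrite !(mul1r, mul0r, add0r, addr0, sub0r) => /andP[/eqP h1 /eqP h2].
  by split; apply/eqP; rewrite -(eqr_int R) !(rmorphD, rmorphB) /=; apply/eqP; lra.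
rewrite {}sE {}uE => hX hY.
pose n : int := s1 ^+ 2 + s2 ^+ 2; pose m : int := u1 ^+ 2 + u2 ^+ 2.
have nE : n%:~R = s1%:~R ^+ 2 + s2%:~R ^+ 2 :> R by rewrite rmorphD !rmorphXn.
have mE : m%:~R = u1%:~R ^+ 2 + u2%:~R ^+ 2 :> R by rewrite rmorphD !rmorphXn.
have t3 : t < 1/2 by rewrite ltNge; apply/negP => ?; have t2 : 0 < t ^+ 2 := exprn_gt0 2 t0; lra.
have t13 : 1/3 < t.
  rewrite ltNge; apply/negP => t13.
  have : t ^+ 2 <= (1/3) ^+ 2 by rewrite ler_sqr ?nnegrE; lra.
  lra.
have : (n%:~R + m%:~R) * (2 - 2 * t) < 4 :> R.
  rewrite nE mE; move: hX hY; rewrite /nsq /=.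
  have -> : 2 - 2 * t = 1 + 2 * t ^+ 2 by lra.
  lra.
move=> nm4; have {nm4} nm : n + m < 4.
  rewrite -(ltr_int R) rmorphD /= ltNge; apply/negP => h.
  have : 4 * (2 - 2 * t) <= (n%:~R + m%:~R) * (2 - 2 * t) by apply: ler_wpM2r => //; lra.
  lra.
have n0 : 0 <= n by rewrite addr_ge0 ?sqr_ge0.
have m0 : 0 <= m by rewrite addr_ge0 ?sqr_ge0.
have [h hE] : exists h, n + m = 2 * h.
  exists (a1 ^+ 2 + a2 ^+ 2 + (a1 - a2) * s1 + (a1 + a2) * s2 + s1 ^+ 2 + s2 ^+ 2).
  by rewrite /n /m e1 e2; ring.
have z0 (c d : int) : c ^+ 2 + d ^+ 2 = 0 -> c = 0 /\ d = 0.
  by move/eqP; rewrite paddr_eq0 ?sqr_ge0 // !sqrf_eq0 => /andP[/eqP -> /eqP ->].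
have [[nn mm]|[[nn mm]|[[nn mm]|[nn mm]]]] :
  (n = 0 /\ m = 0) \/ (n = 2 /\ m = 0) \/ (n = 0 /\ m = 2) \/ (n = 1 /\ m = 1).
  by move: n m n0 m0 hE nm {nE mE}; clear; lia.
- by have [-> ->] := z0 _ _ nn; have [-> ->] := z0 _ _ mm.
- exfalso; have [U1 U2] := z0 _ _ mm.
  move: hY; rewrite U1 U2 /nsq /=; have : n%:~R = 2 :> R by rewrite nn.
  rewrite nE; lra.
- exfalso; have [U1 U2] := z0 _ _ nn.
  move: hX; rewrite U1 U2 /nsq /=; have : m%:~R = 2 :> R by rewrite mm.
  rewrite mE; lra.
exfalso.
have sg (c : int) : `|c| = 1 -> c%:~R = 1 :> R \/ c%:~R = -1 :> R.
  move=> h1; have [->|->] : c = 1 \/ c = -1 by clear -h1; lia.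
    by left.
  by right.
have un (c d : int) : c ^+ 2 + d ^+ 2 = 1 -> 
    (c%:~R = 0 :> R /\ (d%:~R = 1 :> R \/ d%:~R = -1 :> R)) \/
    (d%:~R = 0 :> R /\ (c%:~R = 1 :> R \/ c%:~R = -1 :> R)).
  by move=> /int_sqr_sum1[[-> /sg]|[-> /sg]]; [left|right].
move: hX hY; rewrite /nsq /=.
by case: (un _ _ nn) => -[-> [|]] ->; case: (un _ _ mm) => -[-> [|]] ->; lra.
Qed.

(* The lattice is spanned by (1, b) and ((1, b) + (a, 1)) / (1 + i), with a = t (1 + i) and
   b = - t (1 - i); x0 and y0 are the ratios of the coordinates of these two vectors. *)
Lemma critical_lattice (k : R) : 0 < k -> k ^+ 2 = 3 ->
  exists x0 y0 (kap : R), [/\ normc x0 = 1, 0 < kap,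
    kap * normc (x0 - y0) * (Num.sqrt 2 / (3 - k)) = 1 &
    forall a b, G a -> G b -> normc (a + b * x0) < 1 -> kap * normc (a + b * y0) < 1 ->
      a = 0 /\ b = 0].
Proof.
move=> k0 k3.
have k2 : k < 2 by rewrite ltNge; apply/negP => ?; nra.
have k1 : 1 < k by rewrite ltNge; apply/negP => ?; nra.
pose t := (k - 1) / 2.
have t0 : 0 < t by rewrite /t; lra.
have tE : 2 * t ^+ 2 + 2 * t = 1 by rewrite /t; lra.
pose a0 : R[i] := t +i* t; pose b0 : R[i] := - t +i* t.
have n1i : nsq (1 + 'i : R[i]) = 2 by rewrite /nsq /= ; ring.
have i1 : 1 + 'i != 0 :> R[i] by apply/eqP => h; move: n1i; rewrite h /nsq /=; lra.
have b00 : b0 != 0.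
  by apply/eqP => -[] _; lra.
have Gi : G (1 + 'i) by apply: gaussD; [exact: gauss1|exists 0, 1].
have c1i : normc (1 + 'i : R[i]) = Num.sqrt 2 by rewrite normc_sqrt n1i.
have s2 : 0 < Num.sqrt 2 :> R by rewrite sqrtr_gt0.
exists ((1 + a0) / (1 + 'i)), ((1 + b0) / ((1 + 'i) * b0)), (normc b0); split.
- have n1a : nsq (1 + a0) = 2 by rewrite /nsq /=; lra.
  by rewrite normc_sqrt nsqM nsqV n1i n1a divff ?sqrtr1 ?pnatr_eq0.
- by rewrite normc_gt0.
(* Here a0 b0 - 1 = - (2 t^2 + 1) = - (2 - 2 t) = - (3 - k). *)
- rewrite -normcM (_ : b0 * _ = (a0 * b0 - 1) / (1 + 'i)); last by field; rewrite b00 i1.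
  rewrite normc_div c1i (_ : a0 * b0 - 1 = (- (3 - k))%:C); last first.
    apply/eqP; rewrite eq_complex /=; apply/andP; split; apply/eqP; last by lra.
    have -> : k = 2 * t + 1 by rewrite /t; lra.
    lra.
  rewrite (_ : normc _ = 3 - k); first by field; apply/andP; split; apply: lt0r_neq0; lra.
  by rewrite normc_sqrt /nsq /= sqrrN expr0n addr0 sqrtr_sqr ger0_norm; lra.
move=> a b Ga Gb h1 h2.
(* Multiplying a + b x0 and b0 (a + b y0) by 1 + i gives the two forms of [critical_form], with
   bound 2 = |1 + i|^2. *)
have [||||b1 u0] := @critical_form t b ((1 + 'i) * a + b) t0 tE Gb.
- by apply: gaussD => //; exact: gaussM.
- by exists a.
- have -> : b * a0 + ((1 + 'i) * a + b) = (a + b * ((1 + a0) / (1 + 'i))) * (1 + 'i) by field.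
  rewrite nsqM n1i; move: h1; rewrite normc_lt1; lra.
- have -> : b + ((1 + 'i) * a + b) * b0 = b0 * (a + b * ((1 + b0) / ((1 + 'i) * b0))) * (1 + 'i).
    by field; rewrite b00 i1.
  rewrite nsqM n1i; move: h2; rewrite -normcM normc_lt1; lra.
split=> //; move: u0; rewrite b1 addr0 => /eqP; rewrite mulf_eq0 (negbTE i1) => /eqP //.
Qed.

(** With w = C/c = kap C |x0 - y0| < 1, choose rho < 1 with rho^2 > w. Then both a + b x and kap (a
    + b y) have modulus at most rho, so b is bounded through b (x - y), and moving (x, y) to (x0,
    y0) costs less than 1 - rho. *)
Lemma critical_stable (x0 y0 : R[i]) (kap c C : R) : 0 < kap -> 0 < c -> 0 < C -> C < c ->
  kap * normc (x0 - y0) * c = 1 ->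
  (forall a b, G a -> G b -> normc (a + b * x0) < 1 -> kap * normc (a + b * y0) < 1 ->
      a = 0 /\ b = 0) ->
  exists rho eta : R, [/\ 0 < rho, 0 < eta, eta <= 1, 4 * eta <= normc (x0 - y0) &
    forall x y, normc (x - x0) <= eta -> normc (y - y0) <= eta ->
    forall a b, G a -> G b -> normc (a + b * x) < rho ->
      normc (a + b * y) <= C * normc (x - y) / rho -> a = 0 /\ b = 0].
Proof.
move=> kap0 c0 C0 Cc kc crit.
pose L := normc (x0 - y0).
have L0 : 0 < L.
  rewrite lt_neqAle normc_ge0 andbT eq_sym; apply/eqP => h.
  by move: kc; rewrite -/L h mulr0 mul0r; lra.
pose w := C / c.
have w1 : w < 1 by rewrite /w ltr_pdivrMr // mul1r.
have w0 : 0 < w by rewrite divr_gt0.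
have wE : kap * C * L = w.
  by rewrite /w -[C in RHS]mulr1 -kc -/L; field; exact: lt0r_neq0.
pose rho := (1 + w) / 2.
have rho1 : rho < 1 by rewrite /rho; lra.
have rho0 : 0 < rho by rewrite /rho; lra.
have rw : w < rho ^+ 2.
  rewrite -subr_gt0 (_ : _ - _ = ((1 - w) / 2) ^+ 2); last by rewrite /rho; field.
  by rewrite exprn_gt0 //; lra.
pose M := 2 * (1 + kap^-1) / L.
have ik0 : 0 < kap^-1 by rewrite invr_gt0.
have M0 : 0 < M by apply: divr_gt0 => //; apply: mulr_gt0 => //; exact: addr_gt0.
(* [e1] ensures kap C (L + 2 eta) <= rho^2; [e2] ensures that M eta fits in the gap 1 - rho. *)
pose e1 := (rho ^+ 2 - w) / (2 * kap * C).
pose e2 := (1 - rho) / (M * (1 + kap) * 2).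
have e10 : 0 < e1 by apply: divr_gt0; [rewrite subr_gt0|do !apply: mulr_gt0].
have e20 : 0 < e2.
  by apply: divr_gt0; [rewrite subr_gt0|apply: mulr_gt0 => //; apply: mulr_gt0 => //;
    exact: addr_gt0].
exists rho, (Num.min 1 (Num.min (L / 4) (Num.min e1 e2))).
set eta := Num.min 1 _.
have eta0 : 0 < eta by rewrite !lt_min ltr01 e10 e20 divr_gt0.
have eta1 : eta <= 1 by rewrite ge_min lexx.
have etaL : eta <= L / 4 by rewrite !ge_min lexx !orbT.
have etae1 : eta <= e1 by rewrite !ge_min lexx !orbT.
have etae2 : eta <= e2 by rewrite !ge_min lexx !orbT.
split=> //; first by rewrite -/L; lra.
move=> x y hx hy a b Ga Gb h1 h2.
have xyU : normc (x - y) <= L + 2 * eta.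
  rewrite (_ : x - y = (x0 - y0) + ((x - x0) - (y - y0))); last by ring.
  apply: le_trans (le_normcD _ _) _; rewrite lerD2l (le_trans (normcB _ _)) //; lra.
have xyL : L / 2 <= normc (x - y).
  have : L <= normc (x - y) + 2 * eta.
    rewrite /L (_ : x0 - y0 = (x - y) - ((x - x0) - (y - y0))); last by ring.
    apply: le_trans (normcB _ _) _; rewrite lerD2l (le_trans (normcB _ _)) //; lra.
  lra.
have ky : kap * normc (a + b * y) <= rho.
  apply: (@le_trans _ _ (kap * (C * normc (x - y) / rho))); first by rewrite ler_pM2l.
  rewrite !mulrA ler_pdivrMr //.
  apply: (@le_trans _ _ (kap * C * (L + 2 * eta))).
    by rewrite ler_pM2l // mulr_gt0.
  rewrite mulrDr wE -expr2.
  have : eta * (2 * kap * C) <= rho ^+ 2 - w by rewrite -ler_pdivlMr // !mulr_gt0.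
  lra.
have bM : normc b <= M.
  have : normc b * normc (x - y) <= rho + rho / kap.
    rewrite -normcM (_ : b * (x - y) = (a + b * x) - (a + b * y)); last by ring.
    apply: le_trans (normcB _ _) _; apply: lerD; first exact: ltW.
    by rewrite ler_pdivlMr // mulrC.
  have : normc b * (L / 2) <= normc b * normc (x - y) by rewrite ler_wpM2l ?normc_ge0.
  have : rho + rho / kap <= 1 + kap^-1.
    by apply: lerD; [exact: ltW|rewrite ler_piMl ?invr_ge0 ?ltW].
  move=> ? ? ?; rewrite /M ler_pdivlMr //; lra.
have bd : normc b * eta <= (1 - rho) / ((1 + kap) * 2).
  apply: (@le_trans _ _ (M * e2)); first by rewrite ler_pM ?normc_ge0 // ltW.
  rewrite /e2 le_eqVlt; apply/orP; left; apply/eqP; field.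
  by rewrite !lt0r_neq0 //; lra.
have bd' : normc b * eta * ((1 + kap) * 2) <= 1 - rho.
  by rewrite -ler_pdivlMr // mulr_gt0 //; lra.
have be0 : 0 <= normc b * eta by rewrite mulr_ge0 ?normc_ge0 // ltW.
have bek : 0 <= normc b * eta * kap by rewrite mulr_ge0 // ltW.
apply: crit => //.
  rewrite (_ : a + b * x0 = (a + b * x) - b * (x - x0)); last by ring.
  apply: le_lt_trans (normcB _ _) _; rewrite normcM.
  have : normc b * normc (x - x0) <= normc b * eta by rewrite ler_wpM2l ?normc_ge0.
  lra.
rewrite (_ : a + b * y0 = (a + b * y) - b * (y - y0)); last by ring.
apply: (@le_lt_trans _ _ (kap * (normc (a + b * y) + normc (b * (y - y0))))).
  by rewrite ler_pM2l // normcB.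
rewrite normcM mulrDr.
have : normc b * normc (y - y0) <= normc b * eta by rewrite ler_wpM2l ?normc_ge0.
rewrite -(ler_pM2l kap0); lra.
Qed.

End Critical.

(** * Discs where a smaller constant fails *)

Section Holes.
Variable R : realType.
Local Notation G := (@gaussian_integers R).
Implicit Types (p q z a b x y : R[i]).

(** The constant C fails at the bound rho |q|. A solution (Q, P) has integral coordinates a, b in
    the basis (q, p), (q', p'); dividing by q and by r = q z - p gives a + b x and a + b y, with |x
    - y| = 1/|q r|. *)
Lemma not_dirichlet (C rho : R) q p q' p' z : G q -> G p -> G q' -> G p' ->
  q * p' - p * q' = 1 -> q != 0 -> q * z - p != 0 -> 0 < rho -> 1 < rho * normc q ->
  (forall a b, G a -> G b -> normc (a + b * (q' / q)) < rho ->
     normc (a + b * ((q' * z - p') / (q * z - p))) <=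
       C * normc (q' / q - (q' * z - p') / (q * z - p)) / rho -> a = 0 /\ b = 0) ->
  ~ dirichlet_constant z C.
Proof.
move=> Gq Gp Gq' Gp' det q0 r0 rho0 rq1 H dir.
have [P [Q [GP GQ]]] := dir _ rq1.
rewrite !normr_normc -[0]/(0%:C) !ltcR lecR normc_gt0 => /andP[Q0 QB] QP.
pose r := q * z - p; pose r' := q' * z - p'.
have rr : q' / q - r' / r = (q * r)^-1.
  have e : q' * r - q * r' = 1 by rewrite -det /r /r'; ring.
  rewrite -/r in r0; rewrite -[RHS]mul1r -e; move: r0 {e}; rewrite -/r; move: r r' => r r' r0.
  by field; rewrite q0 r0.
pose a := Q * p' - P * q'; pose b := q * P - p * Q.
have QE : Q = q * (a + b * (q' / q)).
  rewrite -[LHS]mulr1 -det /a /b; by field.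
have rE : Q * z - P = r * (a + b * (r' / r)).
  rewrite -[LHS]mulr1 -det /a /b /r /r'; by field.
have [||||a0 b0] := H a b.
- by apply: gaussB; exact: gaussM.
- by apply: gaussB; exact: gaussM.
- by move: QB; rewrite QE normcM mulrC ltr_pM2r // normc_gt0.
- rewrite -/r -/r' rr normcV normcM.
  move: QP; rewrite rE normcM mulrC -ler_pdivlMr ?normc_gt0 //.
  congr (_ <= _); field.
  by rewrite lt0r_neq0 //= !normc_eq0 r0 q0.
by move: Q0; rewrite QE a0 b0 mul0r addr0 mulr0 eqxx.
Qed.

(* With g a Gaussian integer close to n x0, the matrix (n^2, n g - 1; n g + 1, g^2) has
   determinant 1; for large n its action on w is close to (n g + 1) / n^2, whatever w is. *)
Lemma basis_change (x0 : R[i]) (eta : R) : normc x0 = 1 -> 0 < eta ->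
  exists a b c d : R[i], [/\ [/\ G a, G b, G c & G d], a * d - b * c = 1 &
    forall w, normc w <= 3/4 -> 1 <= normc (a + b * w) /\
      normc ((c + d * w) / (a + b * w) - x0) <= eta].
Proof.
move=> x01 eta0.
(* n >= 7 makes the denominator at least n^2/8; n >= 10/eta makes the three error terms, each at
   most 1/n, sum to less than eta. *)
pose N := (Num.truncn (10 / eta) + 7)%N; set n : R := N%:R.
have n7 : 7 <= n by rewrite /n ler_nat leq_addl.
have nE : 10 / eta <= n.
  apply: ltW; apply: lt_le_trans (truncnS_gt _) _.
  by rewrite ler_nat /N addnS ltnS leq_addr.
have n0 : 0 < n by lra.
pose nc : R[i] := n%:C.
have Gn : G nc by exists N%:Z, 0.
have nn : normc nc = n by rewrite normc_sqrt /nsq /= expr0n addr0 sqrtr_sqr ger0_norm // ltW.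
have nc0 : nc != 0 by rewrite -normc_gt0 nn.
have [g [Gg g1 g2]] := round_gauss (nc * x0).
have {g1 g2} gd : normc (nc * x0 - g) <= 1 by rewrite normc_le1; have := nsq_le_half g1 g2; lra.
have gn : normc g <= n + 1.
  rewrite -[g](subKr (nc * x0)) (le_trans (normcB _ _)) // normcM nn x01 mulr1; lra.
exists (nc * nc), (nc * g - 1), (nc * g + 1), (g * g); split.
- split; first exact: gaussM.
  + by apply: gaussB; [exact: gaussM|exact: gauss1].
  + by apply: gaussD; [exact: gaussM|exact: gauss1].
  + exact: gaussM.
- by ring.
move=> w w34; set q := nc * nc + _.
have qL : n ^+ 2 / 8 <= normc q.
  have h1 : normc (nc * g - 1) <= n * (n + 1) + 1.
    by apply: le_trans (normcB _ _) _; rewrite normcM nn normc1 lerD2r ler_pM2l.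
  have h2 : normc (nc * nc) - normc ((nc * g - 1) * w) <= normc q.
    by have := normc_leB (nc * nc) (- ((nc * g - 1) * w)); rewrite opprK normcN.
  have h3 : normc ((nc * g - 1) * w) <= (n * (n + 1) + 1) * (3/4).
    by rewrite normcM; apply: ler_pM; rewrite ?normc_ge0.
  have h4 : 0 <= n * (n - 7) by apply: mulr_ge0; lra.
  move: h2; rewrite normcM nn; lra.
have n49 : 7 * 7 <= n ^+ 2 by rewrite expr2; apply: ler_pM.
have q0 : q != 0 by rewrite -normc_gt0; lra.
split; first lra.
have -> : (nc * g + 1 + g * g * w) / q - x0 =
    w / (nc * nc * q) + ((nc^-1 * nc^-1) - (nc * x0 - g) / nc).
  by move: nc0 q0; rewrite /q; clearbody nc => ? ?; field; apply/andP.
apply: le_trans (le_normcD _ _) _.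
have nV : normc nc^-1 = n^-1 by rewrite normcV nn.
have b1 : normc (w / (nc * nc * q)) <= n^-1.
  rewrite normc_div !normcM nn ler_pdivrMr; last by rewrite !mulr_gt0 ?normc_gt0.
  rewrite !mulrA mulVf ?lt0r_neq0 // mul1r.
  have : 7 * 1 <= n * normc q by apply: ler_pM; lra.
  lra.
have b2 : normc (nc^-1 * nc^-1) <= n^-1.
  by rewrite normcM nV ler_piMl ?invr_ge0 ?(ltW n0) // invf_le1; lra.
have b3 : normc ((nc * x0 - g) / nc) <= n^-1.
  by rewrite normc_div nn ler_piMl ?invr_ge0 ?(ltW n0).
have b4 : n^-1 <= eta / 10.
  by rewrite ler_pdivlMr // mulrC ler_pdivrMr // mulrC -ler_pdivrMr.
have := normcB (nc^-1 * nc^-1) ((nc * x0 - g) / nc); lra.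
Qed.

(* y = q' z - p' over q z - p is a Moebius function of z, and y = y0 exactly at the centre
   p / q - 1 / (q^2 (y0 - q' / q)). *)
Lemma hole_moebius (eta L : R) (y0 : R[i]) q p q' p' z (s := (z - (p / q - (q ^+ 2 * (y0 - q' /
  q))^-1)) * q ^+ 2) :
  q * p' - p * q' = 1 -> q != 0 -> 0 < eta -> 0 < L -> y0 - q' / q != 0 ->
    normc (y0 - q' / q) <= L ->
  normc s * L <= 1/2 -> normc s * (2 * L ^+ 2) <= eta ->
  q * z - p != 0 /\ normc ((q' * z - p') / (q * z - p) - y0) <= eta.
Proof.
move=> det q0 eta0 L0 v0 vL s1 s2.
pose v := y0 - q' / q; pose r := q * z - p.
have rE : r * (q * v) = s * v - 1.
  by rewrite /r /s -/v; field; rewrite q0 v0.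
have sv : normc (s * v) <= 1/2.
  by rewrite normcM (le_trans _ s1) // ler_wpM2l ?normc_ge0.
have d0 : 1/2 <= normc (1 - s * v) by have := normc_leB 1 (s * v); rewrite normc1; lra.
have d00 : 1 - s * v != 0 by rewrite -normc_gt0; lra.
have r0 : r != 0.
  apply/eqP => h; move: rE; rewrite h mul0r => /eqP; rewrite eq_sym subr_eq0 => /eqP h'.
  by move: d00; rewrite h' subrr eqxx.
split=> //.
(* Since the determinant is 1, the left side is - v - 1/(q r), and [rE] evaluates q r. *)
have -> : (q' * z - p') / (q * z - p) - y0 = v ^+ 2 * s / (1 - s * v).
  have e : q' * r - q * (q' * z - p') = 1 by rewrite -det /r; ring.
  have -> : q' * z - p' = (q' * r - 1) / q by rewrite -e; field.
  have qr : q * r = (s * v - 1) / v by rewrite -rE; field.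
  have -> : (q' * r - 1) / q / (q * z - p) - y0 = - v - (q * r)^-1.
    by rewrite -/r /v; field; rewrite q0 r0.
  rewrite qr; field; rewrite d00 v0 /= -opprB oppr_eq0; exact: d00.
rewrite normc_div ler_pdivrMr; last lra.
apply: (@le_trans _ _ (eta * (1/2))); last by rewrite ler_pM2l.
rewrite normcM; have -> : normc (v ^+ 2) = normc v ^+ 2 by rewrite !expr2 normcM.
have : normc v ^+ 2 <= L ^+ 2 by rewrite ler_sqr ?nnegrE ?normc_ge0 // ltW.
move=> h; have : normc v ^+ 2 * normc s <= L ^+ 2 * normc s by rewrite ler_wpM2r ?normc_ge0.
lra.
Qed.

End Holes.

(** * Negligibility *)

Section Null.
Variable R : realType.
Local Notation G := (@gaussian_integers R).
Implicit Types (p q z a b x y : R[i]).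

Lemma hole_near_rational (k C : R) : 0 < k -> k ^+ 2 = 3 -> k < 3 -> 0 < C ->
  C < Num.sqrt 2 / (3 - k) ->
  exists K d B : R, [/\ 0 < K, 0 < d, 0 < B &
    forall q p u v, G q -> G p -> G u -> G v -> q != 0 -> u * q + v * p = 1 -> B < normc q ->
    exists h, normc (h - p / q) <= K / normc q ^+ 2 /\
      forall z, normc (z - h) <= d / normc q ^+ 2 -> ~ dirichlet_constant z C].
Proof.
move=> k0 k3 k33 C0 Cc.
have c0 : 0 < Num.sqrt 2 / (3 - k) by rewrite divr_gt0 ?sqrtr_gt0 ?subr_gt0.
have [x0 [y0 [kap [x01 kap0 kapc crit]]]] := critical_lattice k0 k3.
have [rho [eta [rho0 eta0 eta1 etaL stable]]] := critical_stable kap0 c0 C0 Cc kapc crit.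
have [a [b [c [d [[Ga Gb Gc Gd] abcd basis]]]]] := basis_change x01 eta0.
set l := normc (x0 - y0) in etaL.
have l0 : 0 < l by lra.
pose L := l + 1.
have L0 : 0 < L by rewrite /L; lra.
pose A := normc a + normc b.
have A1 : 1 <= A.
  have [] := basis 0; first by rewrite normc0; lra.
  by rewrite mulr0 addr0 => h _; rewrite /A (le_trans h) // lerDl normc_ge0.
(* The largest deviation that meets both smallness conditions of [hole_moebius]. *)
pose s0 := Num.min (1 / (2 * L)) (eta / (2 * L ^+ 2)).
have s00 : 0 < s0 by rewrite lt_min !divr_gt0 // mulr_gt0 // exprn_gt0.
have s1 : s0 * L <= 1/2.
  have : s0 <= 1 / (2 * L) by rewrite ge_min lexx.
  by rewrite ler_pdivlMr ?mulr_gt0 //; lra.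
have s2 : s0 * (2 * L ^+ 2) <= eta.
  by rewrite -ler_pdivlMr ?mulr_gt0 ?exprn_gt0 // /s0 ge_min lexx orbT.
(* K: |p1/q1 - p/q| = |b|/|q q1|, and the centre is within 2/(l |q|^2) of p1/q1. d: |q1| <= A |q|.
   B: it gives 1 < rho |q1|. *)
exists (normc b + 2 / l), (s0 / A ^+ 2), rho^-1; split.
- by rewrite ltr_wpDl ?normc_ge0 // divr_gt0.
- by rewrite divr_gt0 // exprn_gt0 //; lra.
- by rewrite invr_gt0.
move=> q p u v Gq Gp Gu Gv q0 uv qB.
(* (q', p') = (-v, u) - m (q, p) completes (q, p) to a basis, with |q'/q|^2 <= 1/2 so that
   [basis_change] applies. *)
have [m [Gm hm]] := gauss_divmod (gaussN Gv) Gq q0.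
set q' := - v - m * q in hm.
pose p' := u - m * p.
have Gq' : G q' by apply: gaussB; [exact: gaussN|exact: gaussM].
have Gp' : G p' by apply: gaussB => //; exact: gaussM.
have det : q * p' - p * q' = 1 by rewrite -uv /p' /q'; ring.
pose w := q' / q.
have nq0 : 0 < normc q by rewrite normc_gt0.
have w34 : normc w <= 3/4.
  have n34 : 0 <= 3/4 * normc q by rewrite mulr_ge0 ?normc_ge0 // divr_ge0.
  rewrite /w normc_div ler_pdivrMr // -(ler_sqr) ?nnegrE ?normc_ge0 //.
  rewrite exprMn !normc_sqr; have := nsq_ge0 q; lra.
have [abw xw] := basis w w34.
pose q1 := a * q + b * q'; pose p1 := a * p + b * p'.
pose q1' := c * q + d * q'; pose p1' := c * p + d * p'.
have q1E : q1 = q * (a + b * w) by rewrite /q1 /w; field.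
have ab0 : a + b * w != 0 by rewrite -normc_gt0; lra.
have q10 : q1 != 0 by rewrite q1E mulf_neq0.
have Gq1 : G q1 by apply: gaussD; exact: gaussM.
have Gp1 : G p1 by apply: gaussD; exact: gaussM.
have Gq1' : G q1' by apply: gaussD; exact: gaussM.
have Gp1' : G p1' by apply: gaussD; exact: gaussM.
have det1 : q1 * p1' - p1 * q1' = 1.
  rewrite (_ : _ - _ = (a * d - b * c) * (q * p' - p * q')); first by rewrite abcd det mulr1.
  by rewrite /q1 /p1 /q1' /p1'; ring.
have nq1 : normc q <= normc q1 by rewrite q1E normcM ler_peMr ?normc_ge0.
have nq1A : normc q1 <= A * normc q.
  rewrite q1E normcM mulrC ler_pM2r // (le_trans (le_normcD _ _)) // lerD2l normcM.
  by rewrite ler_piMr ?normc_ge0 //; lra.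
have xx0 : normc (q1' / q1 - x0) <= eta.
  rewrite (_ : q1' / q1 = (c + d * w) / (a + b * w)) // q1E /q1' /w; field.
  by rewrite q0 (_ : a * q + b * q' = q1) ?q10.
pose V := y0 - q1' / q1.
have VL : normc V <= L.
  rewrite /V (_ : _ - _ = (y0 - x0) - (q1' / q1 - x0)); last by ring.
  by rewrite (le_trans (normcB _ _)) // normc_distC -/l /L; lra.
have Vl : l / 2 <= normc V.
  have : l <= normc V + normc (q1' / q1 - x0).
    rewrite /l normc_distC (_ : y0 - x0 = V + (q1' / q1 - x0)); last by rewrite /V; ring.
    exact: le_normcD.
  lra.
have V0 : V != 0 by rewrite -normc_gt0; lra.
exists (p1 / q1 - (q1 ^+ 2 * V)^-1); split.
  have -> : p1 / q1 - (q1 ^+ 2 * V)^-1 - p / q = b / (q * q1) - (q1 ^+ 2 * V)^-1.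
    have e : p1 * q - p * q1 = b by rewrite -[RHS]mulr1 -det /p1 /q1; ring.
    by rewrite -e; field; rewrite q0 q10 V0.
  rewrite (le_trans (normcB _ _)) // mulrDl; apply: lerD.
    rewrite normc_div normcM ler_wpM2l ?normc_ge0 // lef_pV2 ?posrE ?mulr_gt0 ?normc_gt0
      ?exprn_gt0 //.
    by rewrite expr2 ler_pM2l.
  have h1 : normc q ^+ 2 * (l / 2) <= normc q1 ^+ 2 * normc V.
    apply: ler_pM => //; rewrite ?sqr_ge0 ?divr_ge0 ?(ltW l0) //.
    by rewrite ler_sqr ?nnegrE ?normc_ge0.
  have h0 : 0 < normc q ^+ 2 * (l / 2) by rewrite mulr_gt0 ?exprn_gt0 ?divr_gt0.
  have -> : 2 / l / normc q ^+ 2 = (normc q ^+ 2 * (l / 2))^-1 by field; rewrite !lt0r_neq0.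
  have -> : normc (q1 ^+ 2 * V)^-1 = (normc q1 ^+ 2 * normc V)^-1.
    by rewrite normcV normcM !expr2 normcM.
  by rewrite lef_pV2 // posrE // (lt_le_trans h0).
move=> z zh.
have sb : normc ((z - (p1 / q1 - (q1 ^+ 2 * V)^-1)) * q1 ^+ 2) <= s0.
  rewrite normcM; have -> : normc (q1 ^+ 2) = normc q1 ^+ 2 by rewrite !expr2 normcM.
  apply: (@le_trans _ _ (s0 / A ^+ 2 / normc q ^+ 2 * (A * normc q) ^+ 2)).
    apply: ler_pM => //; rewrite ?normc_ge0 ?sqr_ge0 //.
    by rewrite ler_sqr ?nnegrE ?normc_ge0 // mulr_ge0 ?normc_ge0 //; lra.
  rewrite le_eqVlt; apply/orP; left; apply/eqP; field.
  by rewrite !lt0r_neq0 //; lra.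
have [||r0 yy0] := @hole_moebius R eta L y0 q1 p1 q1' p1' z det1 q10 eta0 L0 V0 VL.
- by apply: le_trans s1; rewrite ler_pM2r.
- by apply: le_trans s2; rewrite ler_pM2r // mulr_gt0 // exprn_gt0.
apply: (@not_dirichlet R C rho q1 p1 q1' p1') => //.
  rewrite mulrC -ltr_pdivrMr // mul1r; exact: lt_le_trans nq1.
by move=> a' b'; apply: stable.
Qed.

Lemma normc_ge_Re z : `|Re z| <= normc z.
Proof.
case: z => x y /=; rewrite -[leLHS]sqrtr_sqr ler_wsqrtr // lerDl sqr_ge0 //.
Qed.

Lemma normc_ge_Im z : `|Im z| <= normc z.
Proof.
case: z => x y /=; rewrite -[leLHS]sqrtr_sqr ler_wsqrtr // lerDr sqr_ge0 //.
Qed.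

Lemma normc_le_ReIm z : normc z <= `|Re z| + `|Im z|.
Proof.
rewrite -(ler_sqr) ?nnegrE ?normc_ge0 ?addr_ge0 // normc_sqr /nsq sqrrD !real_normK ?num_real //.
rewrite -addrA lerD2l lerDr mulrn_wge0 // mulr_ge0 //.
Qed.

Lemma gauss_rationals_countable : exists f : nat -> R * R,
  forall z, ~ range f (Re z, Im z) -> forall p q, G p -> G q -> q != 0 -> q * z - p != 0.
Proof.
pose v (t : int * int * int * int) : R[i] :=
  (t.1.1.1%:~R +i* t.1.1.2%:~R) / (t.1.2%:~R +i* t.2%:~R).
exists (fun n => if @unpickle (int * int * int * int)%type n is Some t then (Re (v t), Im (v
  t)) else (0, 0)).
move=> z nz p q [p1 [p2 pE]] [q1 [q2 qE]] q0; apply/eqP => h; apply: nz.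
exists (pickle (p1, p2, q1, q2)) => //; rewrite pickleK.
suff -> : v (p1, p2, q1, q2) = z by [].
transitivity (p / q); first by rewrite pE qE.
by apply: (mulIf q0); rewrite divfK // mulrC; apply/eqP; rewrite eq_sym -subr_eq0 h.
Qed.

(** The best error e over 0 < |q| < M + 2 is positive, so a solution for Q with c/Q < e must have
    |q| > M, even after removal of the common divisor. *)
Lemma good_coprime_approx (k c : R) z (M : R) : 0 < k -> k ^+ 2 = 3 -> 1 <= c ->
  c ^+ 2 * (6 - 3 * k) = 1 -> 0 <= M ->
  (forall p q, G p -> G q -> q != 0 -> q * z - p != 0) ->
  exists q p u v, [/\ [/\ G q, G p, G u & G v], q != 0, u * q + v * p = 1, M < normc q &
    normc (z - p / q) <= c / normc q ^+ 2].
Proof.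
move=> k0 k3 c1 ck M0 irr.
have M1 : 1 < M + 2 by lra.
have c0 : 0 < c by lra.
have [q0 [p0 [Gq0 Gp0 q00 _ min0]]] := best_gauss_approx z M1.
pose e := normc (q0 * z - p0).
have e0 : 0 < e by rewrite normc_gt0; exact: irr.
pose Q := 1 + c / e.
have ce0 : 0 < c / e by rewrite divr_gt0.
have Q1 : 1 < Q by rewrite ltrDl.
have cQ : c / Q < e.
  rewrite ltr_pdivrMr; last exact: lt_trans Q1.
  by rewrite /Q mulrDr mulr1 mulrCA mulfV ?lt0r_neq0 // mulr1 ltrDr.
have [P0 [Q0 [GP0 GQ0]]] := dirichlet_constant_optimal z k0 k3 c0 c1 ck Q1.
rewrite !normr_normc -[0]/(0%:C) !ltcR lecR normc_gt0 => /andP[Q00 QB] QP.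
have [|d [u [v [q [p [[Gd Gu Gv Gq Gp] d0 qE pE uv]]]]]] := gauss_bezout GQ0 GP0.
  by case=> h; rewrite h eqxx in Q00.
have d1 := normc_gauss_ge1 Gd d0.
have q_neq0 : q != 0 by apply: contra Q00 => /eqP h; rewrite qE h mulr0.
have yq : normc (q * z - p) <= c / Q.
  apply: le_trans QP; rewrite (_ : Q0 * z - P0 = d * (q * z - p)); last by rewrite qE pE; ring.
  by rewrite normcM ler_peMl ?normc_ge0.
have nqQ : normc q <= Q.
  apply: le_trans (ltW QB); rewrite qE normcM; rewrite ler_peMl ?normc_ge0 //.
exists q, p, u, v; split => //.
  rewrite ltNge; apply/negP => qM.
  have := min0 q p Gq Gp q_neq0 ltac:(lra); rewrite -ler_normc leNgt => /negP; apply.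
  exact: le_lt_trans cQ.
have nq0 : 0 < normc q by rewrite normc_gt0.
have -> : z - p / q = (q * z - p) / q by field.
rewrite normc_div expr2 invfM mulrA ler_pM2r ?invr_gt0 //.
by apply: le_trans yq _; rewrite ler_pM2l // lef_pV2 ?posrE //; lra.
Qed.

Lemma dirichlet_null (k C : R) : 0 < k -> k ^+ 2 = 3 -> 0 < C -> C < Num.sqrt 2 / (3 - k) ->
  lebesgue_nullC [set z : R[i] | dirichlet_constant z C].
Proof.
move=> k0 k3 C0 Cc.
have k2 : k < 2 by rewrite ltNge; apply/negP => ?; nra.
have k33 : k < 3 by lra.
pose c := Num.sqrt 2 / (3 - k).
have c0 : 0 < c by rewrite divr_gt0 ?sqrtr_gt0 ?subr_gt0.
have cE : c ^+ 2 * (6 - 3 * k) = 1.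
  rewrite /c expr_div_n sqr_sqrtr // mulrAC (_ : 2 * (6 - 3 * k) = (3 - k) ^+ 2) ?divff //;
    last lra.
  by rewrite expf_neq0 // subr_eq0 gt_eqF.
have c1 : 1 <= c.
  rewrite -(ler_sqr) ?nnegrE ?(ltW c0) // expr1n.
  have k17 : 17/10 < k by rewrite ltNge; apply/negP => ?; nra.
  have : c ^+ 2 * (6 - 3 * k) <= c ^+ 2 * 1 by apply: ler_wpM2l; rewrite ?sqr_ge0 //; lra.
  lra.
have [K [d [B [K0 d0 B0 hole]]]] := hole_near_rational k0 k3 k33 C0 Cc.
have [f fP] := gauss_rationals_countable.
pose bad : set (R * R) := [set xy | ~ dirichlet_constant (xy.1 +i* xy.2) C].
(* The interior is taken because [porous_negligible] asks for an open set; the holes, being open,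
   lie in it. *)
suff N : ((@lebesgue_measure R) \x (@lebesgue_measure R))%E.-negligible (~` bad°).
  by apply: negligibleS N => xy /= dir /interior_subset; exact.
(* h is within (K + c)/|q|^2 of z. The factor d' is such that a square of half side d' S/|q|^2 fits
   in the disc of radius d/|q|^2. *)
pose S := K + c + 1.
have S0 : 0 < S by rewrite /S; lra.
pose d' := Num.min 1 (d / (2 * S)).
have d'0 : 0 < d' by rewrite lt_min ltr01 divr_gt0 // mulr_gt0.
have d'S : d' * (2 * S) <= d by rewrite -ler_pdivlMr ?mulr_gt0 // /d' ge_min lexx orbT.
apply: (@porous_negligible R d' _ f) => //.
- by rewrite ge_min lexx.
- exact: open_interior.
move=> [x y] nz e e0; pose z : R[i] := x +i* y.
(* |q| > M gives |q| > B, |q| >= 1 and S/|q|^2 < e. *)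
pose M := B + 1 + S / e.
have Se : 0 < S / e by rewrite divr_gt0.
have M0 : 0 <= M by rewrite /M; lra.
have [q [p [u [v [[Gq Gp Gu Gv] q0 uv Mq zpq]]]]] := good_coprime_approx k0 k3 c1 cE M0 (fP z nz).
have nq0 : 0 < normc q by rewrite normc_gt0.
have nq2 : 0 < normc q ^+ 2 by rewrite exprn_gt0.
have [|h [hpq hbad]] := hole q p u v Gq Gp Gu Gv q0 uv; first by rewrite /M in Mq; lra.
have zh : normc (z - h) <= (K + c) / normc q ^+ 2.
  rewrite (_ : z - h = (z - p / q) - (h - p / q)); last by ring.
  by rewrite (le_trans (normcB _ _)) // mulrDl addrC lerD.
have r1 : (K + c) / normc q ^+ 2 < S / normc q ^+ 2 by rewrite ltr_pM2r ?invr_gt0 // /S; lra.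
exists (Re h, Im h), (S / normc q ^+ 2); split.
- by rewrite divr_gt0.
- have q1 : 1 <= normc q by rewrite /M in Mq; lra.
  rewrite ltr_pdivrMr // mulrC -ltr_pdivrMr //.
  have : normc q <= normc q ^+ 2 by rewrite expr2 ler_peMl // ltW.
  rewrite /M in Mq; lra.
- split; apply: (le_lt_trans _ (le_lt_trans zh r1)).
    by have := normc_ge_Re (z - h); rewrite /z; case: (h).
  by have := normc_ge_Im (z - h); rewrite /z; case: (h).
rewrite -open_subsetE; last exact: ball_open.
move=> [x' y'] [/= hx hy]; apply: (hbad (x' +i* y')).
apply: le_trans (normc_le_ReIm _) _.
have e1 : `|Re ((x' +i* y') - h)| < d' * (S / normc q ^+ 2) by move: hx;
  rewrite /ball /= distrC; case: (h).
have e2 : `|Im ((x' +i* y') - h)| < d' * (S / normc q ^+ 2) by move: hy;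
  rewrite /ball /= distrC; case: (h).
apply: (@le_trans _ _ (d' * (2 * S) / normc q ^+ 2)); last by rewrite ler_pM2r ?invr_gt0.
rewrite (_ : d' * (2 * S) / _ = d' * (S / normc q ^+ 2) + d' * (S / normc q ^+ 2)); last by ring.
by rewrite lerD ?ltW.
Qed.

Lemma dirichlet_constant_mono z (C C' : R) : C <= C' -> dirichlet_constant z C ->
  dirichlet_constant z C'.
Proof.
move=> CC dir Q Q1; have [p [q [Gp Gq qQ h]]] := dir Q Q1; exists p, q; split => //.
by apply: le_trans h _; rewrite lecR ler_pM2r // invr_gt0; lra.
Qed.

End Null.

Theorem theorem5 (R : realType) :
  let c : R := Num.sqrt 2 / (3 - Num.sqrt 3) in
  [/\ forall z : R[i], dirichlet_constant z c,
      c = 1 / Num.sqrt (6 - 3 * Num.sqrt 3),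
      1 + 115 / 10 ^+ 3 + 355 / 10 ^+ 6 <= c
        < 1 + 115 / 10 ^+ 3 + 356 / 10 ^+ 6 &
      lebesgue_nullC [set z : R[i] |
        exists2 C : R, C < c & dirichlet_constant z C]].
Proof.
move=> c; set k : R := Num.sqrt 3.
have k0 : 0 < k by rewrite sqrtr_gt0.
have k3 : k ^+ 2 = 3 by rewrite sqr_sqrtr.
(* Two consecutive convergents of sqrt 3 enclose k. *)
have kl : 3691 / 2131 < k.
  rewrite ltNge; apply/negP => h.
  have : k ^+ 2 <= (3691 / 2131) ^+ 2 by rewrite ler_sqr ?nnegrE; lra.
  rewrite k3; lra.
have ku : k < 1351 / 780.
  rewrite ltNge; apply/negP => h.
  have : (1351 / 780) ^+ 2 <= k ^+ 2 by rewrite ler_sqr ?nnegrE; lra.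
  rewrite k3; lra.
have c0 : 0 < c by rewrite divr_gt0 ?sqrtr_gt0 // subr_gt0 -/k; lra.
(* This form makes the bounds on c^2 linear in k. *)
have c2 : c ^+ 2 * 3 = 2 + k.
  rewrite /c -/k expr_div_n sqr_sqrtr //.
  have -> : 2 / (3 - k) ^+ 2 * 3 = 6 / (3 - k) ^+ 2 by ring.
  apply: (mulIf (x := (3 - k) ^+ 2)); first by rewrite expf_neq0 // subr_eq0 gt_eqF //; lra.
  rewrite divfK; last by rewrite expf_neq0 // subr_eq0 gt_eqF //; lra.
  have : k ^+ 3 = 3 * k by rewrite exprSr k3.
  lra.
have ck : c ^+ 2 * (6 - 3 * k) = 1.
  have : c ^+ 2 * 3 * (2 - k) = (2 + k) * (2 - k) by rewrite c2.
  lra.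
have cl : 1 + 115 / 10 ^+ 3 + 355 / 10 ^+ 6 <= c.
  rewrite leNgt; apply/negP => h.
  have : c ^+ 2 < (1 + 115 / 10 ^+ 3 + 355 / 10 ^+ 6) ^+ 2 by rewrite ltr_sqr ?nnegrE; lra.
  lra.
have cu : c < 1 + 115 / 10 ^+ 3 + 356 / 10 ^+ 6.
  rewrite ltNge; apply/negP => h.
  have : (1 + 115 / 10 ^+ 3 + 356 / 10 ^+ 6) ^+ 2 <= c ^+ 2 by rewrite ler_sqr ?nnegrE; lra.
  lra.
split.
- by move=> z; apply: (@dirichlet_constant_optimal R k) => //; lra.
- have d0 : 0 < Num.sqrt (6 - 3 * k) by rewrite sqrtr_gt0; lra.
  apply: (mulIf (lt0r_neq0 d0)); rewrite divfK ?lt0r_neq0 //.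
  by rewrite -[c in LHS](ger0_norm (ltW c0)) -sqrtr_sqr -sqrtrM ?sqr_ge0 // ck sqrtr1.
- by rewrite cl cu.
(* The constants c - 1/(n + 2) are positive since c > 1 and converge to c, so by monotonicity every
   C < c is covered by a countable union. *)
have N : ((@lebesgue_measure R) \x (@lebesgue_measure R))%E.-negligible
    (\bigcup_n [set xy : R * R | dirichlet_constant (xy.1 +i* xy.2) (c - n.+2%:R^-1)]).
  apply: negligible_bigcup => n; apply: (@dirichlet_null R k) => //.
    have n1 : n.+2%:R^-1 <= 1 :> R by rewrite invf_le1 ?ler1n.
    by rewrite subr_gt0 (le_lt_trans n1) //; clear -cl; lra.
  by rewrite ltrBlDr ltrDl invr_gt0.
apply: negligibleS N => xy /= [C Cc dir].
have Cc' : 0 < c - C by rewrite subr_gt0.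
have [n _ /(_ n.+1 (leqnSn n)) /= nC] := near_infty_natSinv_lt (PosNum Cc').
exists n => //=; apply: dirichlet_constant_mono dir; rewrite lerBrDr -lerBrDl; exact: ltW.
Qed.
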